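(* Let $X$ be a locally compact separable metrizable space, $m$ a positive Radon measure on $X$ with full support, and $\mathscr{E}$ a regular semi-Dirichlet form on $L^2(X)=L^2(X,m)$ with semigroup $(T_t)_{t\ge 0}$, resolvent $(G_\alpha)_{\alpha>0}$ and associated Hunt process. Assume property (P): for every compact $K\subset X$ there is $w\in L^2(X)\cap L^\infty_0(X)$, $w\ge 0$, with $G_1w\ge\mathbf{1}_K$. Then the following assertions are equivalent: (1) $\mathscr{E}$ satisfies the $L^\infty_0$-diffusion property, i.e. $T_t(L^\infty_0(X))\subset L^\infty_0(X)$ for all $t>0$. (2) For every compact $K\subset X$ and every $t\ge 0$ the function $x\mapsto \mathbb{P}^x\{\sigma_K\le t\}$ belongs to $L^\infty_0(X)$. (3) For every compact $K\subset X$ one has $e_K\in L^\infty_0(X)$. (4) For every compact $K\subset X$ there exists a $1$-excessive function $\phi\in\mathscr{F}$ with $\mathbf{1}_K\le\phi$ and $\phi\in L^\infty_0(X)$.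
   Context: A semi-Dirichlet form on $L^2(X)$ is a pair $(\mathscr{E},\mathscr{F})$ with $\mathscr{F}\subset L^2(X)$ a dense subspace and $\mathscr{E}:\mathscr{F}\times\mathscr{F}\to\mathbb{R}$ bilinear such that: $\mathscr{E}(u,u)\ge 0$; (sector condition) there is $C\ge 1$ with $|\mathscr{E}(u,v)|\le C\,\mathscr{E}(u,u)^{1/2}\mathscr{E}(v,v)^{1/2}$; $\mathscr{F}$ is complete with respect to $\|u\|_{\mathscr{E}}=(\mathscr{E}(u,u)+\|u\|_2^2)^{1/2}$; (Markovian property) for all $u\in\mathscr{F}$, $a\ge 0$ one has $u\wedge a\in\mathscr{F}$ and $\mathscr{E}(u\wedge a,u-u\wedge a)\ge 0$. It is regular if $\mathscr{F}\cap C_c(X)$ is dense in $(\mathscr{F},\|\cdot\|_{\mathscr{E}})$ and in $(C_c(X),\|\cdot\|_\infty)$. $H$ is the maximally sectorial operator in $L^2(X)$ associated with $\mathscr{E}$ by Kato's first representation theorem, $T_t=e^{-tH}$ and $G_\alpha=(H+\alpha)^{-1}$. The semigroup is sub-Markovian and extends consistently to a weak-*-continuous contraction semigroup on $L^\infty(X)$, also denoted $T_t$ (likewise $G_\alpha$). Inequalities between functions are meant $m$-a.e. $L^\infty_0(X)$ is the space of all $u\in L^\infty(X)$ such that for every $\epsilon>0$ there is a compact $K\subset X$ with $\|\mathbf{1}_{X\setminus K}u\|_\infty<\epsilon$. $(\Omega,(\mathbb{P}^x)_{x\in X},(X_t)_{t\ge 0})$ is the Hunt process (with lifetime $\zeta\in(0,\infty]$)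 associated with the regular semi-Dirichlet form $\mathscr{E}$ by the standard theory (Fukushima; Ma–Röckner; Oshima); in particular $T_tf(x)=\mathbb{E}^x[\mathbf{1}_{\{t<\zeta\}}f(X_t)]$ for all $t>0$, $f\in L^2(X)$ and $m$-a.e. $x$. For a Borel set $B\subset X$ the first hitting time is $\sigma_B=\inf\{t>0: X_t\in B\}$ (with $\inf\emptyset=\infty$), and the $1$-equilibrium potential is $e_B(x)=\mathbb{E}^x(e^{-\sigma_B})$ (with $e^{-\infty}=0$). A function $u\in L^p(X)$, $1\le p\le\infty$, is $1$-excessive if $e^{-t}T_tu\le u$ for all $t>0$. *)

(* Defs.v *)
From HB Require Import structures.
From mathcomp Require Import all_boot all_order all_algebra.
From mathcomp Require Import all_classical all_reals all_analysis.
From mathcomp Require Import ess_sup_inf measurable_realfun.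

Set Implicit Arguments.
Unset Strict Implicit.
Unset Printing Implicit Defensive.

Import Order.TTheory GRing.Theory Num.Theory.
Import numFieldNormedType.Exports.

Local Open Scope classical_set_scope.
Local Open Scope ring_scope.

(* The library's measurable types are pointed, hence so is the state space.
   Nothing below depends on the metric except through its topology. *)
#[short(type="pmetricType")]
HB.structure Definition PointedMetric (K : numDomainType) :=
  {M of Pointed M & Metric K M}.

Notation borel T := (g_sigma_algebraType (@open T)).
Notation borel_set T := (measurable : set (set (borel T))).
Notation opc := one_point_compactification.

Definition separable_space (T : topologicalType) :=
  exists2 D : set T, countable D & dense D.

(* An element of L^p is represented by a Borel function with finite p-norm
   ([Lfun]); equalities and inequalities between such functions are taken
   m-a.e. *)

Section Spaces.
Context {R : realType} {X : ptopologicalType}.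
Variable m : {measure set (borel X) -> \bar R}.
Implicit Types u v f g w : X -> R.

Record radon_measure : Prop := {
  radon_finite : forall K : set X, compact K -> (m K < +oo)%E ;
  radon_inner_regular : forall B : set X, borel_set X B ->
    m B = ereal_sup [set m K | K in [set K : set X | compact K /\ K `<=` B]]
}.

Definition full_support :=
  forall U : set X, open U -> U !=set0 -> (0 < m U)%E.

Definition inner u v : R := \int[m]_x (u x * v x).

Definition norm2 u : R := fine 'N[m]_2%:E[EFin \o u]%E.

Definition Cc u : Prop := continuous u /\ compact (closure [set x | u x != 0]).

Definition Linfty0 u : Prop :=
  u \in Lfun m +oo%E /\
  forall e : R, 0 < e -> exists2 K : set X, compact K &
    ('N[m]_+oo[EFin \o (fun x => \1_(~` K) x * u x)%R] < e%:E)%E.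

(* Membership in L^oo_0 of the m-class of a function which is not assumed to be
   Borel: hitting probabilities are in general measurable only with respect to
   the completion of the Borel sigma-algebra. *)
Definition in_Linfty0 u : Prop := exists2 v, Linfty0 v & u = v %[ae m].

Section Form.
Variables (F : set (X -> R)) (E : (X -> R) -> (X -> R) -> R).

Definition form_norm u : R := Num.sqrt (E u u + norm2 u ^+ 2).

Record semi_dirichlet_form : Prop := {
  form_dom_L2 : forall u, F u -> u \in Lfun m 2%:E ;
  form_dom_ae : forall u v,
    F u -> v \in Lfun m 2%:E -> u = v %[ae m] -> F v ;
  form_dom_linear : forall (a : R) u v,
    F u -> F v -> F (fun x => a * u x + v x) ;
  form_dom_dense : forall u, u \in Lfun m 2%:E -> forall e : R, 0 < e ->
    exists2 v, F v & norm2 (u \- v) < e ;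
  form_ae : forall u u' v v', F u -> F u' -> F v -> F v' ->
    u = u' %[ae m] -> v = v' %[ae m] -> E u v = E u' v' ;
  form_linearl : forall (a : R) u v w, F u -> F v -> F w ->
    E (fun x => a * u x + v x) w = a * E u w + E v w ;
  form_linearr : forall (a : R) u v w, F u -> F v -> F w ->
    E w (fun x => a * u x + v x) = a * E w u + E w v ;
  form_ge0 : forall u, F u -> 0 <= E u u ;
  form_sector : exists2 C : R, 1 <= C & forall u v, F u -> F v ->
    `|E u v| <= C * Num.sqrt (E u u) * Num.sqrt (E v v) ;
  form_complete : forall u_ : nat -> X -> R, (forall n, F (u_ n)) ->
    (forall e : R, 0 < e -> exists N : nat, forall i j : nat,
      (N <= i)%N -> (N <= j)%N -> form_norm (u_ i \- u_ j) < e) ->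
    exists2 u, F u & form_norm (u_ n \- u) @[n --> \oo] --> (0 : R) ;
  form_markov : forall u (a : R), F u -> 0 <= a ->
    let ua := fun x => Num.min (u x) a in F ua /\ 0 <= E ua (u \- ua)
}.

Record regular_form : Prop := {
  regular_dense_dom : forall u, F u -> forall e : R, 0 < e ->
    exists v, [/\ F v, Cc v & form_norm (u \- v) < e] ;
  regular_dense_Cc : forall u, Cc u -> forall e : R, 0 < e ->
    exists v, [/\ F v, Cc v & forall x, `|u x - v x| < e]
}.

(* Graph of the operator H of Kato's first representation theorem:
   u \in D(H) and H u = f. *)
Definition form_operator u f : Prop :=
  [/\ F u, f \in Lfun m 2%:E & forall v, F v -> E u v = inner f v].

(* G a = (H + a)^-1, i.e. H (G a f) = f - a G a f. *)
Definition is_resolvent (G : R -> (X -> R) -> X -> R) : Prop :=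
  forall (a : R) f, 0 < a -> f \in Lfun m 2%:E ->
    form_operator (G a f) (fun x => f x - a * G a f x).

(* T t = e^{-tH} on L^2: the strongly continuous contraction semigroup whose
   generator is -H. *)
Record is_L2_semigroup (T : R -> (X -> R) -> X -> R) : Prop := {
  L2sg_L2 : forall (t : R) u, 0 <= t -> u \in Lfun m 2%:E ->
    T t u \in Lfun m 2%:E ;
  L2sg_linear : forall (t a : R) u v, 0 <= t ->
    u \in Lfun m 2%:E -> v \in Lfun m 2%:E ->
    T t (fun x => a * u x + v x) = (fun x => a * T t u x + T t v x) %[ae m] ;
  L2sg_contraction : forall (t : R) u, 0 <= t -> u \in Lfun m 2%:E ->
    norm2 (T t u) <= norm2 u ;
  L2sg_0 : forall u, u \in Lfun m 2%:E -> T 0 u = u %[ae m] ;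
  L2sg_add : forall (s t : R) u, 0 <= s -> 0 <= t -> u \in Lfun m 2%:E ->
    T (s + t) u = T s (T t u) %[ae m] ;
  L2sg_continuous : forall u, u \in Lfun m 2%:E ->
    norm2 (T t u \- u) @[t --> (0 : R)^'+] --> (0 : R) ;
  L2sg_generator : forall u f, u \in Lfun m 2%:E -> f \in Lfun m 2%:E ->
    form_operator u f <->
    norm2 (fun x => t^-1 * (u x - T t u x) - f x) @[t --> (0 : R)^'+]
      --> (0 : R)
}.

End Form.

(* T acts on L^oo as a weak-*-continuous contraction semigroup. The operators
   T t are themselves weak-*-continuous; as L^2 \cap L^oo is weak-*-dense in
   L^oo, their action on L^oo is then determined by that on L^2. *)
Record is_Linfty_semigroup (T : R -> (X -> R) -> X -> R) : Prop := {
  Linfsg_Linf : forall (t : R) f, 0 <= t -> f \in Lfun m +oo%E ->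
    T t f \in Lfun m +oo%E ;
  Linfsg_linear : forall (t a : R) f g, 0 <= t ->
    f \in Lfun m +oo%E -> g \in Lfun m +oo%E ->
    T t (fun x => a * f x + g x) = (fun x => a * T t f x + T t g x) %[ae m] ;
  Linfsg_contraction : forall (t : R) f, 0 <= t -> f \in Lfun m +oo%E ->
    ('N[m]_+oo[EFin \o T t f] <= 'N[m]_+oo[EFin \o f])%E ;
  Linfsg_0 : forall f, f \in Lfun m +oo%E -> T 0 f = f %[ae m] ;
  Linfsg_add : forall (s t : R) f, 0 <= s -> 0 <= t -> f \in Lfun m +oo%E ->
    T (s + t) f = T s (T t f) %[ae m] ;
  Linfsg_weak_star_operator : forall t : R, 0 <= t ->
    forall g, g \in Lfun m 1%E -> forall e : R, 0 < e ->
    exists (n : nat) (h : 'I_n -> X -> R),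
      (forall i, h i \in Lfun m 1%E) /\
      exists2 dl : R, 0 < dl & forall f, f \in Lfun m +oo%E ->
        (forall i, `|inner f (h i)| < dl) -> `|inner (T t f) g| < e ;
  Linfsg_weak_star_time : forall f g, f \in Lfun m +oo%E -> g \in Lfun m 1%E ->
    {within `[0, +oo[%classic, continuous (fun t : R => inner (T t f) g)}
}.

Definition property_P (G : R -> (X -> R) -> X -> R) : Prop :=
  forall K : set X, compact K -> exists w,
    [/\ w \in Lfun m 2%:E, Linfty0 w, \forall x \ae m, 0 <= w x &
        \forall x \ae m, \1_K x <= G 1 w x].

Definition Linfty0_diffusion (T : R -> (X -> R) -> X -> R) : Prop :=
  forall (t : R) f, 0 < t -> Linfty0 f -> Linfty0 (T t f).

Definition one_excessive (T : R -> (X -> R) -> X -> R) u : Prop :=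
  forall t : R, 0 < t -> \forall x \ae m, expR (- t) * T t u x <= u x.

End Spaces.

Section Paths.
Context {R : realType} {X : ptopologicalType} {Omega : Type}.
(* The cemetery is the point at infinity [None]. Only times t >= 0 matter. *)
Variable path : R -> Omega -> opc X.

Definition path_lifetime (w : Omega) : \bar R :=
  ereal_inf [set t%:E | t in [set t : R | 0 <= t /\ path t w = None]].

Definition path_hitting_time (B : set X) (w : Omega) : \bar R :=
  ereal_inf [set t%:E | t in [set t : R | 0 < t /\ (Some @` B) (path t w)]].

End Paths.

Section StoppingTimes.
Context {R : realType} {d : measure_display} {Omega : measurableType d}.
Variable M : R -> set (set Omega).

Definition stopping_time (s : Omega -> \bar R) : Prop :=
  (forall w, (0 <= s w)%E) /\
  forall t : R, 0 <= t -> M t [set w | (s w <= t%:E)%E].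

Definition stopped_events (s : Omega -> \bar R) : set (set Omega) :=
  [set A | measurable A /\
    forall t : R, 0 <= t -> M t (A `&` [set w | (s w <= t%:E)%E])].

End StoppingTimes.

(* The strong Markov property and quasi-left-continuity are stated under the
   laws P^x; for an initial distribution mu they follow by integration in x.
   The strong Markov property
     P^x(X_{s + r} \in B | M_s) = P^{X_s}(X_r \in B)   P^x-a.s.
   is written out by integrating over the events of M_s; on {s = oo} it is void
   since X_oo is the cemetery. Right-continuity of the filtration contains its
   monotonicity. *)
Record hunt_process (R : realType) (X : ptopologicalType)
    (d : measure_display) (Omega : measurableType d) := {
  hunt_law : opc X -> probability Omega R ;
  hunt_path : R -> Omega -> opc X ;
  hunt_shift : R -> Omega -> Omega ;
  hunt_filtration : R -> set (set Omega) ;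
  hunt_filtration_sigma : forall t : R, 0 <= t ->
    sigma_algebra setT (hunt_filtration t) ;
  hunt_filtration_sub : forall t : R, 0 <= t ->
    hunt_filtration t `<=` measurable ;
  hunt_filtration_right_continuous : forall t : R, 0 <= t ->
    hunt_filtration t = \bigcap_(s in [set s | t < s]) hunt_filtration s ;
  hunt_adapted : forall (t : R) (B : set (opc X)), 0 <= t ->
    borel_set (opc X) B -> hunt_filtration t (hunt_path t @^-1` B) ;
  hunt_law_measurable : forall (t : R) (B : set (opc X)), 0 <= t ->
    borel_set (opc X) B ->
    measurable_fun [set: borel (opc X)]
      (fun x => hunt_law x (hunt_path t @^-1` B)) ;
  hunt_normal : forall x, hunt_law x (hunt_path 0 @^-1` [set x]) = 1%E ;
  hunt_right_continuous : forall (w : Omega) (t : R), 0 <= t ->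
    hunt_path s w @[s --> t^'+] --> hunt_path t w ;
  hunt_left_limits : forall (w : Omega) (t : R), 0 < t ->
    exists l : opc X, hunt_path s w @[s --> t^'-] --> l ;
  hunt_absorbing : forall (w : Omega) (t : R), 0 <= t ->
    (path_lifetime hunt_path w <= t%:E)%E -> hunt_path t w = None ;
  hunt_shiftE : forall (s t : R) (w : Omega), 0 <= s -> 0 <= t ->
    hunt_path s (hunt_shift t w) = hunt_path (s + t) w ;
  hunt_strong_markov :
    forall (x : opc X) (s : Omega -> \bar R) (A : set Omega) (r : R)
           (B : set (opc X)),
    stopping_time hunt_filtration s -> stopped_events hunt_filtration s A ->
    0 <= r -> borel_set (opc X) B ->
    hunt_law x (A `&` [set w | (s w < +oo)%E /\
                               B (hunt_path (fine (s w) + r) w)]) =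
    (\int[hunt_law x]_(w in A `&` [set w | s w < +oo])
       hunt_law (hunt_path (fine (s w)) w) (hunt_path r @^-1` B))%E ;
  hunt_quasi_left_continuous :
    forall (x : opc X) (s_ : nat -> Omega -> \bar R) (s : Omega -> \bar R),
    (forall n, stopping_time hunt_filtration (s_ n)) ->
    (forall w n, (s_ n w <= s_ n.+1 w)%E) ->
    (forall w, s_ n w @[n --> \oo] --> s w) ->
    \forall w \ae hunt_law x, (s w < +oo)%E ->
      hunt_path (fine (s_ n w)) w @[n --> \oo] --> hunt_path (fine (s w)) w
}.

Section HuntProcess.
Context {R : realType} {X : ptopologicalType}.
Context {d : measure_display} {Omega : measurableType d}.
Variable Z : hunt_process R X Omega.

Definition lifetime : Omega -> \bar R := path_lifetime (hunt_path Z).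

Definition hitting_time (B : set X) : Omega -> \bar R :=
  path_hitting_time (hunt_path Z) B.

(* P^x, extended to the completion: hitting times need not be measurable with
   respect to the uncompleted sigma-algebra. *)
Definition completed_law (x : X) :
    {measure set (caratheodory_type (hunt_law Z (Some x))^*%mu) -> \bar R} :=
  @completed_measure_extension _ _ _ (hunt_law Z (Some x)).

Definition hitting_probability (B : set X) (t : R) (x : X) : R :=
  fine (completed_law x [set w | (hitting_time B w <= t%:E)%E]).

Definition equilibrium_potential (B : set X) (x : X) : R :=
  fine (\int[completed_law x]_w expeR (- hitting_time B w))%E.

(* T_t f(x) = E^x[1_{t < zeta} f(X_t)]; the value of [oapp f 0] at the cemetery
   is irrelevant, since X_t \in X for t < zeta. *)
Definition associated_process (m : {measure set (borel X) -> \bar R})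
    (T : R -> (X -> R) -> X -> R) : Prop :=
  forall (t : R) (f : X -> R), 0 < t -> f \in Lfun m 2%:E ->
    \forall x \ae m,
      (T t f x)%:E = (\int[hunt_law Z (Some x)]_w
        (if (t%:E < lifetime w)%E then oapp f 0 (hunt_path Z t w) else 0)%:E)%E.

End HuntProcess.

(* Main.v *)
(* A 1-excessive phi >= 1_U with U open dominates, for every n and dl, the
   functions v_0 = 1_U, v_(k+1) = 1_U + 1_(U^c) T_dl v_k up to the factor
   e^(k dl); by the Markov property v_n is the probability of a visit to U at one
   of the times 0, dl, ..., n dl. Letting the mesh tend to 0,
   P^x(sigma_K <= t) <= e^(t+1) phi(x) for a.e. x whenever K is contained in U,
   which gives (4) => (2). For (2) => (3), e_K <= P^x(sigma_K <= t) + e^-t, and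
   (3) => (1) follows from e^-t T_t 1_K(x) = e^-t P^x(X_t \in K) <= e_K(x).
   For (1) => (4) take phi = G_1 w, with w given by (P): it is the weak integral of
   e^-s T_s w over s > 0, and it vanishes at infinity because, for a compact
   exhaustion (L_n) and eps > 0, the times s <= S at which |T_s w| exceeds eps
   off L_n form open sets decreasing to the empty set.
   The functions in (2) and (3) must moreover be measurable: by
   quasi-left-continuity, {sigma_K <= t} is a.s. equal to a countable monotone
   combination of events "the path visits U_j at a time of a finite grid", whose
   probabilities are Borel in x. *)

(* The process represents [T t f] only for a fixed t and a fixed f, off an m-null set depending on
   both. Hence a majorant phi is never followed along a path: it is compared with functions of the
   starting point alone, one grid step at a time, and only countably many grids are combined, so
   that the exceptional sets still form a null set. A grid detects visits to open sets only, by
   right-continuity of the paths. Assertion (4) is therefore applied to a compact neighbourhood L of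
   K, and K itself is recovered from open sets inside L that shrink to K. On the analytic side s |->
   T_s w is only weak-* continuous, so G_1 w is controlled through its pairings with indicators of
   sets D of finite measure. Such a pairing <T_s u, 1_D> solves a scalar linear differential
   equation, and an estimate by b m(D), valid for all D, is an a.e. bound by b. The same weak
   continuity dictates how the exceptional times in (1) => (4) are defined: by the existence of a
   test set D rather than by an essential supremum, since only the former condition is visibly open
   in s. *)
Require Import Defs.
From HB Require Import structures.
From mathcomp Require Import all_boot all_order all_algebra.
From mathcomp Require Import all_classical all_reals all_analysis.
From mathcomp Require Import ess_sup_inf measurable_realfun ring lra.

Set Implicit Arguments.
Unset Strict Implicit.
Unset Printing Implicit Defensive.

Import Order.TTheory GRing.Theory Num.Theory.
Import numFieldNormedType.Exports.

Local Open Scope classical_set_scope.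
Local Open Scope ring_scope.

(** * Almost everywhere inequalities and L^p *)

Section AlmostEverywhere.
Context {R : realType} {X : ptopologicalType}.
Variable m : {measure set (borel X) -> \bar R}.
Implicit Types P Q S : X -> Prop.

Lemma aeS P Q : (forall x, P x -> Q x) ->
  (\forall x \ae m, P x) -> \forall x \ae m, Q x.
Proof. exact: (@filterS _ (almost_everywhere m) (ae_filter_ringOfSetsType m)). Qed.

Lemma aeS2 P Q S : (forall x, P x -> Q x -> S x) ->
  (\forall x \ae m, P x) -> (\forall x \ae m, Q x) -> \forall x \ae m, S x.
Proof. exact: (@filterS2 _ (almost_everywhere m) (ae_filter_ringOfSetsType m)). Qed.

Lemma aeS3 P Q S P' : (forall x, P x -> Q x -> S x -> P' x) ->
  (\forall x \ae m, P x) -> (\forall x \ae m, Q x) -> (\forall x \ae m, S x) ->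
  \forall x \ae m, P' x.
Proof. exact: (@filterS3 _ (almost_everywhere m) (ae_filter_ringOfSetsType m)). Qed.

Lemma ae_all P : (forall x, P x) -> \forall x \ae m, P x.
Proof. by move=> h; exact: aeW. Qed.

Lemma ae_ex P : (0 < m [set: X])%E -> (\forall x \ae m, P x) -> exists x, P x.
Proof.
move=> m0 mP; apply: contrapT => /forallNP nP; case: mP => N [mN N0 NP].
have NT : N = [set: X] by apply/seteqP; split=> // x _; apply: NP => /=; exact: nP.
by move: m0; rewrite -NT N0 ltxx.
Qed.

End AlmostEverywhere.

Section Lp.
Context {R : realType} {X : ptopologicalType}.
Variable m : {measure set (borel X) -> \bar R}.
Implicit Types u v f g h : X -> R.

Lemma Lfun_measurable f p : f \in Lfun m p -> measurable_fun [set: borel X] f.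
Proof. by rewrite inE => /andP[/[!inE]]. Qed.

(** If m X = 0 the norm is 0 by convention while every bound holds a.e., so the two sides would
    differ for negative [c]; hence the hypothesis. *)
Lemma LnormyP f c : (0 < m [set: X])%E ->
  ('N[m]_+oo[EFin \o f] <= c%:E)%E <-> \forall x \ae m, `|f x| <= c.
Proof.
move=> mX; rewrite unlock mX; split.
  move=> /ess_supP; apply: aeS => x /=; by rewrite lee_fin.
move=> fc; apply/ess_supP; move: fc; apply: aeS => x /=; by rewrite lee_fin.
Qed.

Lemma LfunyP f : (0 < m [set: X])%E -> f \in Lfun m +oo%E <->
  measurable_fun [set: borel X] f /\ exists c : R, \forall x \ae m, `|f x| <= c.
Proof.
move=> mX; split=> [|[mf [c fc]]].
  rewrite inE => /andP[/[!inE]/= mf]; rewrite /finite_norm => finf; split=> //.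
  have Nf : ('N[m]_+oo[EFin \o f] \is a fin_num)%E.
    by rewrite ge0_fin_numE ?Lnorm_ge0.
  exists (fine 'N[m]_+oo[EFin \o f])%E; apply/LnormyP => //; by rewrite fineK.
rewrite inE; apply/andP; split; rewrite inE//=.
rewrite /finite_norm; apply: le_lt_trans (ltry c).
exact/LnormyP.
Qed.

Lemma Lnorm2E f :
  ('N[m]_2%:E[EFin \o f] = (\int[m]_x (f x ^+ 2)%:E) `^ 2^-1)%E.
Proof.
rewrite unlock; congr (_ `^ _)%E; apply: eq_integral => x _ /=.
by rewrite powR_mulrn// real_normK ?num_real.
Qed.

Lemma Lfun2P f : f \in Lfun m 2%:E <-> measurable_fun [set: borel X] f /\
  m.-integrable [set: borel X] (EFin \o (fun x => f x ^+ 2)).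
Proof.
split=> [f2|[mf /integrableP[_ fi]]].
  by split; [exact: Lfun_measurable f2|exact: Lfun2_integrable_sqr].
rewrite inE; apply/andP; split; rewrite inE//= /finite_norm Lnorm2E.
apply: poweR_lty; apply: le_lt_trans fi.
by under [leRHS]eq_integral => x _ do rewrite gee0_abs ?lee_fin ?sqr_ge0//.
Qed.

Lemma Lfun2_le f g : measurable_fun [set: borel X] f -> g \in Lfun m 2%:E ->
  (\forall x \ae m, `|f x| <= `|g x|) -> f \in Lfun m 2%:E.
Proof.
move=> mf /Lfun2P[mg gi] fg; apply/Lfun2P; split=> //.
apply/integrableP; split; first exact/measurable_EFinP/measurable_funX.
case/integrableP: gi => mg2; apply: le_lt_trans.
apply: ae_ge0_le_integral => //.
- by apply: measurableT_comp => //; exact/measurable_EFinP/measurable_funX.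
- by apply: measurableT_comp => //; exact/measurable_EFinP/measurable_funX.
- move: fg; apply: aeS => x fg _ /=.
  by rewrite lee_fin !normrX lerXn2r ?nnegrE.
Qed.

Lemma Lfun2_lin (a : R) f g : f \in Lfun m 2%:E -> g \in Lfun m 2%:E ->
  (fun x => a * f x + g x) \in Lfun m 2%:E.
Proof.
move=> f2 g2; have := Lfun_submod_closed m (lee1n 2).
by move=> [_ /(_ a f g f2 g2)].
Qed.

Lemma Lfun2_sub f g : f \in Lfun m 2%:E -> g \in Lfun m 2%:E ->
  (f \- g) \in Lfun m 2%:E.
Proof.
move=> f2 g2; rewrite (_ : _ \- _ = fun x => -1 * g x + f x).
  exact: Lfun2_lin.
by apply/funext => x /=; rewrite mulN1r addrC.
Qed.

Lemma Lfun2_0 : (fun=> 0) \in Lfun m 2%:E.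
Proof. by have [] := Lfun_submod_closed m (lee1n 2). Qed.

Lemma Lfun2_scale (a : R) f : f \in Lfun m 2%:E -> (fun x => a * f x) \in Lfun m 2%:E.
Proof.
move=> f2; have := Lfun2_lin a f2 Lfun2_0.
by rewrite (_ : (fun x => _ + 0) = fun x => a * f x)//; apply/funext => x;
  rewrite addr0.
Qed.

Lemma Lfun_indic (D : set X) : borel_set X D -> (m D < +oo)%E ->
  (\1_D : X -> R) \in Lfun m 2%:E /\ (\1_D : X -> R) \in Lfun m 1%E.
Proof.
move=> mD Dfin.
have i1 : m.-integrable [set: borel X] (EFin \o (\1_D : X -> R)).
  apply/integrableP; split; first exact/measurable_EFinP/measurable_indic.
  under eq_integral => x _ do rewrite gee0_abs ?lee_fin//.
  by rewrite integral_indic// setIT.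
split; last exact/Lfun1_integrable.
apply/Lfun2P; split; first exact: measurable_indic.
move: i1; apply: eq_integrable => // x _ /=.
by rewrite indicE; case: (x \in D); rewrite ?expr1n ?expr0n.
Qed.

Lemma inner_integrable f g : f \in Lfun m 2%:E -> g \in Lfun m 2%:E ->
  m.-integrable [set: borel X] (EFin \o (fun x => f x * g x)).
Proof. by move=> f2 g2; apply/Lfun1_integrable; exact: Lfun2_mul_Lfun1. Qed.

Lemma inner_linl (a : R) f g h : f \in Lfun m 2%:E -> g \in Lfun m 2%:E ->
  h \in Lfun m 2%:E ->
  inner m (fun x => a * f x + g x) h = a * inner m f h + inner m g h.
Proof.
move=> f2 g2 h2; rewrite /inner.
rewrite (_ : (fun x => _ * h x) = fun x => a * (f x * h x) + g x * h x); last first.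
  by apply/funext => x; rewrite mulrDl mulrA.
rewrite RintegralD//.
- by rewrite RintegralZl//; exact: inner_integrable.
- have := inner_integrable f2 h2 => /(integrableZl measurableT a).
  by apply: eq_integrable.
- exact: inner_integrable.
Qed.

Lemma inner_0 h : inner m (fun=> 0) h = 0.
Proof.
rewrite /inner (_ : (fun x : X => _) = cst 0) ?Rintegral_cst ?mul0r//.
by apply/funext => x; rewrite mul0r.
Qed.

Lemma inner_scale (a : R) f h : f \in Lfun m 2%:E -> h \in Lfun m 2%:E ->
  inner m (fun x => a * f x) h = a * inner m f h.
Proof.
move=> f2 h2; have := inner_linl a f2 Lfun2_0 h2.
rewrite inner_0 addr0 => <-; congr inner.
by apply/funext => x; rewrite addr0.
Qed.

Lemma inner_ae f f' h : measurable_fun [set: borel X] f ->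
  measurable_fun [set: borel X] f' -> measurable_fun [set: borel X] h ->
  f = f' %[ae m] -> inner m f h = inner m f' h.
Proof.
move=> mf mf' mh ff'; congr fine; apply: ae_eq_integral => //.
- by apply/measurable_EFinP; exact: measurable_funM.
- by apply/measurable_EFinP; exact: measurable_funM.
- by move: ff'; apply: aeS => x /= + _ => ->.
Qed.

Lemma norm2_ge0 f : 0 <= norm2 m f.
Proof. by rewrite fine_ge0// Lnorm_ge0. Qed.

Lemma inner_le f g : f \in Lfun m 2%:E -> g \in Lfun m 2%:E ->
  `|inner m f g| <= norm2 m f * norm2 m g.
Proof.
move=> f2 g2; have [mf mg] := (Lfun_measurable f2, Lfun_measurable g2).
have fin h : h \in Lfun m 2%:E -> ('N[m]_2%:E[EFin \o h] \is a fin_num)%E.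
  rewrite inE => /andP[_ /[!inE]/=]; rewrite /finite_norm => h2.
  by rewrite ge0_fin_numE ?Lnorm_ge0.
apply: (le_trans (le_normr_Rintegral _ _)) => //; first exact: inner_integrable.
have /(@hoelder _ _ _ m f g 2 2 mf mg (ltr0Sn _ _) (ltr0Sn _ _)) :
  2^-1 + 2^-1 = 1 :> R by lra.
have fgfin : (\int[m]_x (`|f x * g x|%:E) \is a fin_num)%E.
  have /integrableP[_] := inner_integrable f2 g2.
  by rewrite ge0_fin_numE ?integral_ge0.
by rewrite Lnorm1 -lee_fin EFinM /norm2 !fineK ?fin.
Qed.

Lemma norm2_ae f g : f = g %[ae m] -> measurable_fun [set: borel X] f ->
  measurable_fun [set: borel X] g -> norm2 m f = norm2 m g.
Proof.
move=> fg mf mg; rewrite /norm2 !Lnorm2E; congr (fine (_ `^ _)%E).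
apply: ae_eq_integral => //.
- exact/measurable_EFinP/measurable_funX.
- exact/measurable_EFinP/measurable_funX.
- by move: fg; apply: aeS => x + _ /= => ->.
Qed.

Lemma norm2_eq0 f : f \in Lfun m 2%:E -> norm2 m f = 0 -> f = (fun=> 0) %[ae m].
Proof.
move=> f2 f0; have mf := Lfun_measurable f2.
have : ('N[m]_2%:E[EFin \o f] = 0)%E.
  move: f2; rewrite inE => /andP[_ /[!inE]/=]; rewrite /finite_norm => f2.
  by rewrite -[LHS]fineK ?ge0_fin_numE ?Lnorm_ge0//; congr EFin.
move/Lnorm_eq0_eq0 => h.
have : EFin \o f = \0%E %[ae m].
  by apply: h; [exact/measurable_EFinP|rewrite lte_fin ltr0n].
by apply: aeS => x /= /(_ I)[].
Qed.

Lemma norm2_0 : norm2 m (fun=> 0) = 0.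
Proof. by rewrite /norm2 (_ : EFin \o _ = cst 0%E)// Lnorm0. Qed.

Lemma inner_indic_cst (c : R) (D : set X) : borel_set X D -> (m D < +oo)%E ->
  inner m (fun x => c * \1_D x) \1_D = c * fine (m D).
Proof.
move=> mD Dfin; rewrite /inner.
rewrite (_ : (fun x => _) = fun x => c * \1_D x); last first.
  apply/funext => x; rewrite indicE; case: (x \in D); by rewrite ?mulr1 ?mulr0.
have [_ /Lfun1_integrable D1] := Lfun_indic mD Dfin.
by rewrite RintegralZl// /Rintegral integral_indic// setIT.
Qed.

Lemma inner_mono f g h : f \in Lfun m 2%:E -> g \in Lfun m 2%:E ->
  h \in Lfun m 2%:E -> (forall x, 0 <= h x) -> (\forall x \ae m, f x <= g x) ->
  inner m f h <= inner m g h.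
Proof.
move=> f2 g2 h2 h0 fg.
suff : 0 <= inner m (fun x => -1 * f x + g x) h.
  by rewrite inner_linl// mulN1r addrC subr_ge0.
have d2 := Lfun2_lin (-1) f2 g2.
have e : (fun x => -1 * f x + g x) = (fun x => `|-1 * f x + g x|) %[ae m].
  by move: fg; apply: aeS => x fg _; rewrite mulN1r addrC ger0_norm ?subr_ge0.
rewrite (inner_ae _ _ _ e); [|exact: Lfun_measurable d2|
  by apply: measurableT_comp => //; exact: Lfun_measurable d2|
  exact: Lfun_measurable h2].
by apply: Rintegral_ge0 => x _; rewrite mulr_ge0.
Qed.

Lemma Lfun2_indicM f (D : set X) : borel_set X D -> f \in Lfun m 2%:E ->
  (fun x => f x * \1_D x) \in Lfun m 2%:E.
Proof.
move=> mD f2; apply: (Lfun2_le _ f2).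
  by apply: measurable_funM; [exact: Lfun_measurable f2|exact: measurable_indic].
apply: ae_all => x; rewrite indicE; case: (x \in D); rewrite ?mulr1// mulr0 normr0.
exact: normr_ge0.
Qed.

Lemma inner_indic_restrict (D : set X) f :
  inner m (fun x => f x * \1_D x) \1_D = inner m f \1_D.
Proof.
congr fine; apply: eq_integral => x _; rewrite indicE.
by case: (x \in D); rewrite ?mulr1 ?mulr0.
Qed.

Lemma borel_level f (e : R) : measurable_fun [set: borel X] f ->
  borel_set X [set x | e <= f x].
Proof.
move=> /(_ measurableT `[e, +oo[%classic (measurable_itv _)); rewrite setTI.
by congr (borel_set X _); apply/seteqP; split=> x /=; rewrite in_itv/= andbT.
Qed.

Lemma Lfun2_level_finite f (e : R) : f \in Lfun m 2%:E -> 0 < e ->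
  (m [set x | (e <= f x)%R] < +oo)%E.
Proof.
move=> f2 e0; have [mf /integrableP[_ fi]] := (Lfun2P f).1 f2.
set D := [set x | _].
have mD : borel_set X D by exact: borel_level.
have : ((e ^+ 2)%:E * m D < +oo)%E.
  apply: le_lt_trans fi.
  rewrite -[X in (_ * m X)%E]setIT -integral_indic//.
  rewrite -ge0_integralZl ?lee_fin ?sqr_ge0//; last 1 first.
  - exact/measurable_EFinP/measurable_indic.
  apply: ge0_le_integral => //.
  - by move=> x _; rewrite -EFinM lee_fin mulr_ge0 ?sqr_ge0.
  - apply/measurable_EFinP; exact: measurable_funM.
  - by apply: measurableT_comp => //; exact/measurable_EFinP/measurable_funX.
  - move=> x _; rewrite -EFinM indicE gee0_abs ?lee_fin ?sqr_ge0//.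
    case: (boolP (x \in D)); last by rewrite mulr0 sqr_ge0.
    by rewrite inE mulr1 => xD; rewrite lerXn2r ?nnegrE ?(ltW e0)// (le_trans (ltW e0)).
case: (m D) => [r _| |//]; first exact: ltry.
by rewrite gt0_muley// lte_fin exprn_gt0.
Qed.

(** By Chebyshev's inequality the part of [C] where f >= b + 1/(n+1) has finite measure, so it is an
    admissible test set, and the test forces its measure to be 0. *)
Lemma ae_le_test f (C : set X) (b : R) : 0 <= b -> f \in Lfun m 2%:E ->
  borel_set X C ->
  (forall D, borel_set X D -> D `<=` C -> (m D < +oo)%E ->
     inner m f \1_D <= b * fine (m D)) ->
  \forall x \ae m, C x -> f x <= b.
Proof.
move=> b0 f2 mC fD; have mf := Lfun_measurable f2.
suff H (n : nat) : \forall x \ae m, C x -> f x < b + n.+1%:R^-1.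
  have := ae_foralln H; apply: aeS => x xn Cx.
  rewrite leNgt; apply/negP => /ltr_add_invr[n]; rewrite ltNge => /negP; apply.
  exact: ltW (xn n Cx).
set e := b + _.
have e0 : 0 < e by rewrite ltr_wpDl.
pose D := C `&` [set x | e <= f x].
have mD : borel_set X D by apply: measurableI => //; exact: borel_level.
have Dfin : (m D < +oo)%E.
  apply: le_lt_trans (Lfun2_level_finite f2 e0); apply: le_measure; rewrite ?inE.
  - exact: mD.
  - exact: borel_level.
  - exact: subIsetr.
have [D2 _] := Lfun_indic mD Dfin.
have : inner m (fun x => e * \1_D x) \1_D <= inner m f \1_D.
  rewrite -(inner_indic_restrict D f); apply: inner_mono => //.
  - exact: Lfun2_scale.
  - exact: Lfun2_indicM.
  - apply: ae_all => x; rewrite indicE; case: (boolP (x \in D)); rewrite ?mulr0//.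
    by rewrite inE !mulr1 => -[].
rewrite inner_indic_cst// => /le_trans/(_ (fD _ mD (@subIsetl _ _ _) Dfin)).
rewrite -subr_ge0 -mulrBl /e opprD addrA subrr add0r mulNr oppr_ge0.
rewrite pmulr_rle0// => mD0.
have {}mD0 : m D = 0%E.
  have mDf : m D \is a fin_num by rewrite ge0_fin_numE.
  by rewrite -[LHS]fineK//; congr EFin; apply/eqP; rewrite eq_le mD0 fine_ge0.
exists D; split=> // x /= /not_implyP[Cx /negP]; rewrite -leNgt => ex; by split.
Qed.

Lemma ae_norm_le_test f (C : set X) (b : R) : 0 <= b -> f \in Lfun m 2%:E ->
  borel_set X C ->
  (forall D, borel_set X D -> D `<=` C -> (m D < +oo)%E ->
     `|inner m f \1_D| <= b * fine (m D)) ->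
  \forall x \ae m, C x -> `|f x| <= b.
Proof.
move=> b0 f2 mC fD.
have A1 : \forall x \ae m, C x -> f x <= b.
  apply: ae_le_test => // D mD DC Df.
  by apply: le_trans (fD _ mD DC Df); exact: ler_norm.
have A2 : \forall x \ae m, C x -> -1 * f x <= b.
  apply: ae_le_test => //; first exact: Lfun2_scale.
  move=> D mD DC Df; apply: le_trans (fD _ mD DC Df).
  have [D2 _] := Lfun_indic mD Df.
  by rewrite inner_scale// mulN1r -normrN ler_norm.
move: A1 A2; apply: aeS2 => x A1 A2 Cx; rewrite ler_norml A1// andbT.
by rewrite lerNl -mulN1r A2.
Qed.

Lemma inner_indic_le f (D : set X) (b : R) : 0 <= b -> f \in Lfun m 2%:E ->
  borel_set X D -> (m D < +oo)%E -> (\forall x \ae m, D x -> `|f x| <= b) ->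
  `|inner m f \1_D| <= b * fine (m D).
Proof.
move=> b0 f2 mD Df fb; have [D2 _] := Lfun_indic mD Df.
rewrite -inner_indic_restrict ler_norml; apply/andP; split.
- rewrite -mulNr -inner_indic_cst//; apply: inner_mono => //.
  + exact: Lfun2_scale.
  + exact: Lfun2_indicM.
  + move: fb; apply: aeS => x; rewrite indicE; case: (boolP (x \in D)).
      by rewrite inE => Dx /(_ Dx); rewrite !mulr1 ler_norml => /andP[].
    by rewrite !mulr0.
- rewrite -inner_indic_cst//; apply: inner_mono => //.
  + exact: Lfun2_indicM.
  + exact: Lfun2_scale.
  + move: fb; apply: aeS => x; rewrite indicE; case: (boolP (x \in D)).
      by rewrite inE => Dx /(_ Dx); rewrite !mulr1 ler_norml => /andP[].
    by rewrite !mulr0.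
Qed.

End Lp.

(** * Compact exhaustions and functions vanishing at infinity *)

Section CompactExhaustion.
Context {R : realType} {X : pmetricType R}.
Hypothesis X_locally_compact : locally_compact [set: X].

(** Finite unions of those closures of balls, with centre in a dense sequence and radius 2/(k+1),
    that happen to be compact. Local compactness puts every point in the interior of one of them. *)
Lemma compact_exhaustion : separable_space X ->
  exists L : nat -> set X, [/\ forall n, compact (L n),
    forall i j, (i <= j)%N -> L i `<=` L j & forall x : X, exists n, nbhs x (L n)].
Proof.
move=> [D /pcard_surjP[q qD] Ddense].
pose B (p : nat * nat) := closure (ball (q p.1) (2 * p.2.+1%:R^-1)).
(* The condition inside the comprehension makes [C i] equal to [B p] if that is compact and empty
   otherwise, so the enumeration needs no case distinction. *)
pose C i := if unpickle i is Some p then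
  [set x | B p x /\ compact (B p)] else set0.
have cC i : compact (C i).
  rewrite /C; case: unpickle => [p|]; last exact: compact0.
  have [cB|ncB] := pselect (compact (B p)).
    by rewrite (_ : [set _ | _] = B p)//; apply/seteqP; split=> x // [].
  by rewrite (_ : [set _ | _] = set0); [exact: compact0|rewrite -subset0 => x []].
pose L n := \big[setU/set0]_(i < n) C i.
have LP n x : L n x <-> exists2 i, (i < n)%N & C i x.
  rewrite /L -bigcup_mkord; split=> [[i /= ni Cx]|[i ni Cx]]; by exists i.
exists L; split.
- by move=> n; rewrite /L; elim/big_ind: _ => //; [exact: compact0|exact: compactU].
- by move=> i j ij x /LP[k ki Cx]; apply/LP; exists k => //; exact: leq_trans ij.
move=> x; have [U] := X_locally_compact (I : [set: X] x).
rewrite withinET => /nbhs_ballP[e /= e0 xeU] [cU clU].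
(* With r = 1/(k+1), a point of the closure of the ball of radius 2r around y is within r + 2r + r =
   4r of x. *)
have [k ke] : exists k : nat, k.+1%:R^-1 < e / 4.
  have /ltr_add_invr[k] : (0 : R) < e / 4 by rewrite divr_gt0.
  by rewrite add0r => ?; exists k.
set r := k.+1%:R^-1 in ke.
have r0 : 0 < r by rewrite /r.
have [y [xy Dy]] : (ball x r)° `&` D !=set0.
  apply: Ddense; last exact: open_interior.
  exists x; exact: nbhs_singleton (nbhs_interior (nbhsx_ballx _ _ r0)).
have [n _ qn] := qD _ Dy.
have xyr : ball x r y by exact: interior_subset.
have BU : B (n, k) `<=` U.
  move=> z /(_ (ball z r) (nbhsx_ballx _ _ r0))[t []]; rewrite /= qn -/r => yt zt.
  apply: xeU; have := ball_triangle xyr (ball_triangle yt (ball_sym zt)).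
  by apply: le_ball; lra.
exists (pickle (n, k)).+1; apply: filterS (nbhsx_ballx _ _ r0) => z xz.
apply/LP; exists (pickle (n, k)) => //; rewrite /C pickleK; split.
  apply: subset_closure; rewrite /= qn -/r.
  by have := ball_triangle (ball_sym xyr) xz; apply: le_ball; lra.
by apply: (subclosed_compact _ cU BU); exact: closed_closure.
Qed.

Lemma exhaustion_absorbs (L : nat -> set X) (K : set X) :
  (forall i j, (i <= j)%N -> L i `<=` L j) ->
  (forall x : X, exists n, nbhs x (L n)) ->
  compact K -> exists n, K `<=` (L n)°.
Proof.
move=> Lmono Lnbhs /compact_near_coveringP/(_ nat \oo (fun n x => (L n)° x)).
have H x : K x -> \forall x' \near x & i \near \oo, (L i)° x'.
  move=> _; have [n xn] := Lnbhs x.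
  near=> x' i => /=; apply: (@interiorS _ (L n)); last by near: x'; exact: nbhs_interior.
  by apply: Lmono; near: i; exact: nbhs_infty_ge.
by move=> /(_ _ H)[n _ /(_ n (leqnn n)) Kn]; exists n.
Unshelve. all: by end_near. Qed.

(** The 1/(n+1)-neighbourhoods of K, cut down to the interior of a member of the exhaustion. The
    last clause is the form in which the hitting argument uses that the closures of the [U n] meet
    in K only: around a point off K, a ball of half its distance to K misses [U n] for large n. *)
Lemma compact_shrinking_nbhs (K : set X) : separable_space X -> compact K ->
  exists (L : set X) (U : nat -> set X), [/\ compact L,
    forall n, open (U n), forall n, K `<=` U n, forall n, U n.+1 `<=` U n &
    (forall n, U n `<=` L) /\
    forall x, ~ K x -> exists2 W, open_nbhs x W & exists n, W `&` U n = set0].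
Proof.
move=> Xsep cK; have [L [cL Lmono Lnbhs]] := compact_exhaustion Xsep.
have [N KN] := exhaustion_absorbs Lmono Lnbhs cK.
pose V n := \bigcup_(y in K) (ball y n.+1%:R^-1)°.
exists (L N), (fun n => (L N)° `&` V n); split => //.
- move=> n; apply: openI; first exact: open_interior.
  by apply: bigcup_open => y _; exact: open_interior.
- move=> n x Kx; split; first exact: KN.
  by exists x => //; exact: nbhs_singleton (nbhs_interior (nbhsx_ballx _ _ _)).
- move=> n x [Lx [y Ky xy]]; split=> //; exists y => //.
  move: xy; apply: interiorS; apply: le_ball.
  by rewrite lef_pV2 ?posrE// ler_nat.
split; first by move=> n x [/interior_subset].
move=> x nKx; have clK : closed K by apply: compact_closed => //; exact: metric_hausdorff.
have /nbhs_ballP[e /= e0 xeK] : nbhs x (~` K).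
  by apply: open_nbhs_nbhs; split=> //; exact: closed_openC.
have [k ke] : exists k : nat, k.+1%:R^-1 < e / 2.
  have /ltr_add_invr[k] : (0 : R) < e / 2 by rewrite divr_gt0.
  by rewrite add0r => ?; exists k.
exists (ball x (e / 2))°.
  split; first exact: open_interior.
  by apply: nbhs_singleton; apply: nbhs_interior; apply: nbhsx_ballx; rewrite divr_gt0.
exists k; rewrite -subset0 => z [/interior_subset xz [_ [y Ky /interior_subset yz]]].
apply: (xeK y) => //; have := ball_triangle xz (ball_sym yz).
by apply: le_ball; rewrite [leRHS]splitr lerD2l ltW.
Qed.

End CompactExhaustion.

Section VanishingAtInfinity.
Context {R : realType} {X : pmetricType R}.
Variable m : {measure set (borel X) -> \bar R}.
Hypothesis m_gt0 : (0 < m [set: X])%E.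
Implicit Types u v f g : X -> R.

Lemma borel_compact (K : set X) : compact K -> borel_set X K.
Proof.
move=> cK; rewrite -[K]setCK; apply: measurableC; apply: sub_sigma_algebra.
by apply: closed_openC; apply: compact_closed => //; exact: metric_hausdorff.
Qed.

Lemma Linfty0P u : Linfty0 m u <-> [/\ measurable_fun [set: borel X] u,
  exists c : R, \forall x \ae m, `|u x| <= c &
  forall e : R, 0 < e -> exists2 K, compact K &
    \forall x \ae m, ~ K x -> `|u x| <= e].
Proof.
split=> [[/LfunyP-/(_ m_gt0)[mu uc] u0]|[mu uc u0]].
  split=> // e /u0[K cK /ltW/LnormyP-/(_ m_gt0) Ke]; exists K => //.
  move: Ke; apply: aeS => x + nKx; rewrite indicE mem_set//= mul1r; exact.
split; first by apply/LfunyP.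
(* Halving [e] recovers the strict inequality in the definition of [Linfty0]. *)
move=> e e0; have [K cK Ke] := u0 _ (divr_gt0 e0 (ltr0Sn _ 1)).
exists K => //; apply: (@le_lt_trans _ _ (e / 2)%:E).
  apply/LnormyP => //; move: Ke; apply: aeS => x Ke; rewrite indicE.
  case: (boolP (x \in ~` K)); last by rewrite mul0r normr0 divr_ge0 ?ltW.
  by rewrite inE mul1r => /Ke.
by rewrite lte_fin ltr_pdivrMr// ltr_pMr// ltr1n.
Qed.

Lemma Linfty0_le u v (c : R) : measurable_fun [set: borel X] u -> Linfty0 m v ->
  (\forall x \ae m, `|u x| <= c * `|v x|) -> Linfty0 m u.
Proof.
move=> mu /Linfty0P[_ [b vb] v0] uv; apply/Linfty0P; split=> //.
  exists (`|c| * b); move: uv vb; apply: aeS2 => x uv vb.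
  apply: (le_trans uv); apply: (le_trans (ler_norm _)).
  by rewrite normrM normr_id ler_wpM2l.
move=> e e0; have c0 : 0 < `|c| + 1 by rewrite ltr_wpDl.
have [K cK Ke] := v0 _ (divr_gt0 e0 c0); exists K => //.
move: uv Ke; apply: aeS2 => x uv Ke nKx; apply: (le_trans uv).
apply: (le_trans (ler_norm _)); rewrite normrM normr_id.
rewrite (le_trans (ler_wpM2l _ (Ke nKx)))// mulrCA ger_pMr// ler_pdivrMr// mul1r.
by rewrite lerDl.
Qed.

End VanishingAtInfinity.

(** * The resolvent as Laplace transform of the semigroup *)

(* Applied to phi t = <T_t u, g> and gam t = <T_t w, g>, where u = G_1 w: then
   phi' = phi - gam, which [phiE] states with an error term rho. *)
Section ResolventFormula.
Context {R : realType}.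
Variables (phi gam rho : R -> R) (C : R).
Hypothesis rho0 : rho h @[h --> 0^'+] --> 0.
Hypothesis phiE : forall a b : R, 0 <= a -> a < b ->
  `|phi b - phi a + (b - a) * (gam a - phi a)| <= (b - a) * rho (b - a).
Hypothesis gam_phi : forall a : R, 0 <= a -> `|gam a - phi a| <= C.
Hypothesis gam_cont : {within `[0, +oo[, continuous gam}.

Let rho_small (e : R) : 0 < e ->
  exists2 d : R, 0 < d & forall h : R, 0 < h -> h < d -> rho h <= e.
Proof.
move=> e0; have /cvgrPdist_le/(_ e e0)[d /= d0 H] := rho0.
exists d => // h h0 hd; have := H h; rewrite /ball_ /= sub0r normrN gtr0_norm//.
by move=> /(_ hd h0); rewrite sub0r normrN; apply: le_trans; exact: ler_norm.
Qed.

(** The 1 bounds [rho] near 0 and [C] bounds gam - phi. The resulting continuity of [phi] is needed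
    for its derivative from the left. *)
Let phi_lip : exists2 d : R, 0 < d & forall a b : R, 0 <= a -> a < b -> b - a < d ->
  `|phi b - phi a| <= (b - a) * (1 + C).
Proof.
have [d d0 H] := rho_small ltr01; exists d => // a b a0 ab abd.
have ba0 : 0 < b - a by rewrite subr_gt0.
have -> : phi b - phi a = (phi b - phi a + (b - a) * (gam a - phi a)) -
    (b - a) * (gam a - phi a) by rewrite addrK.
apply: (le_trans (ler_normB _ _)); rewrite [leRHS]mulrDr lerD//.
  by apply: (le_trans (phiE a0 ab)); rewrite ler_pM2l// H.
by rewrite normrM gtr0_norm// ler_pM2l// gam_phi.
Qed.

Let phi_small (e : R) : 0 < e ->
  exists2 d : R, 0 < d & forall a b : R, 0 <= a -> 0 <= b ->
  `|b - a| < d -> `|phi b - phi a| <= e.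
Proof.
move=> e0; have [d d0 H] := phi_lip.
have C0 : 0 <= C by exact: le_trans (gam_phi (lexx 0)).
have C1 : 0 < 1 + C by rewrite ltr_wpDr.
exists (Num.min d (e / (1 + C))); first by rewrite lt_min d0 divr_gt0.
have H' a b : 0 <= a -> a < b -> `|b - a| < Num.min d (e / (1 + C)) ->
    `|phi b - phi a| <= e.
  move=> a0 ab; rewrite gtr0_norm ?subr_gt0// lt_min => /andP[bad bae].
  apply: (le_trans (H _ _ a0 ab bad)); by rewrite -ler_pdivlMr// ltW.
move=> a b a0 b0; case: (ltgtP a b) => [ab|ba|->]; first exact: H'.
- by rewrite distrC [X in _ -> X <= _]distrC; exact: H'.
- by rewrite !subrr normr0 => _; exact: ltW.
Qed.

Let gam_small (t e : R) : 0 < t -> 0 < e ->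
  exists2 d : R, 0 < d & forall a : R, 0 <= a -> `|t - a| < d -> `|gam t - gam a| <= e.
Proof.
move=> t0 e0.
have t_in : t \in `]0, +oo[ by rewrite in_itv/= t0.
have /continuous_within_itvcyP[gc _] := gam_cont.
have /cvgrPdist_le/(_ e e0)[d /= d0 H] := gc t t_in.
exists d => // a _ tad; exact: H.
Qed.

(** [phiE] is an expansion at the left endpoint. For h > 0 it is used at t directly. For h < 0 it is
    used at t + h, so phi(t + h) and gam(t + h) must be exchanged for their values at t; this costs
    e/4 each, next to e/2 for [rho]. *)
Let phi_derive (t : R) : 0 < t -> is_derive t 1 phi (phi t - gam t).
Proof.
move=> t0.
suff H : h^-1 *: (phi (h *: 1 + t) - phi t) @[h --> 0^'] --> phi t - gam t.
  by apply: DeriveDef; [exact: cvgP H|exact: cvg_lim H].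
apply/cvgrPdist_le => e e0.
have e20 : 0 < e / 2 by rewrite divr_gt0.
have e40 : 0 < e / 4 by rewrite divr_gt0.
have [d1 d10 H1] := rho_small e20.
have [d2 d20 H2] := phi_small e40.
have [d3 d30 H3] := gam_small t0 e40.
exists (Num.min (Num.min d1 d2) (Num.min d3 t)) => /=.
  by rewrite !lt_min d10 d20 d30 t0.
move=> h /=; rewrite sub0r normrN !lt_min => /andP[/andP[hd1 hd2] /andP[hd3 ht]] h0.
rewrite scaler1 /GRing.scale /=.
case: (ltgtP h 0) h0 => // hh _.
- move: hd1 hd2 hd3 ht; rewrite ltr0_norm// => hd1 hd2 hd3 ht.
  have a0 : 0 <= h + t by lra.
  have := phiE a0 (ltac:(lra) : h + t < t).
  rewrite (_ : t - (h + t) = - h); last by ring.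
  have : `|t - (h + t)| < d2 by rewrite (_ : _ - _ = - h) ?gtr0_norm ?oppr_gt0//; ring.
  move=> /(H2 _ _ a0 (ltW t0)) A2.
  have : `|t - (h + t)| < d3 by rewrite (_ : _ - _ = - h) ?gtr0_norm ?oppr_gt0//; ring.
  move=> /(H3 _ a0) A3.
  have nh0 : 0 < - h by rewrite oppr_gt0.
  have A1 := H1 _ nh0 hd1.
  set p := phi (h + t) in A2 *; set g := gam (h + t) in A3 *.
  move=> A.
  have A' : `|(phi t - gam t) - h^-1 * (p - phi t) -
      ((phi t - p) - (gam t - g))| <= rho (- h).
    rewrite -(ler_pM2l nh0); apply: le_trans A.
    rewrite -[X in X * _](gtr0_norm nh0) -normrM.
    rewrite [X in _ <= `|X|](_ : _ = - - h * (phi t - gam t - h^-1 * (p - phi t) -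
      (phi t - p - (gam t - g)))) ?mulNr ?normrN//.
    by field; rewrite lt_eqF.
  set D := _ - h^-1 * _ in A' *.
  rewrite -[D](subrK (phi t - p - (gam t - g))).
  apply: (le_trans (ler_normD _ _)); rewrite [leRHS]splitr lerD//; first exact: le_trans A1.
  by apply: (le_trans (ler_normB _ _)); lra.
- have := phiE (ltW t0) (ltac:(lra) : t < h + t).
  rewrite (_ : h + t - t = h); last by ring.
  move: hd1; rewrite gtr0_norm// => hd1 A.
  apply: (@le_trans _ _ (rho h)); last by apply: le_trans (H1 _ hh hd1) _; lra.
  rewrite -(ler_pM2l hh); apply: le_trans A.
  rewrite -[X in X * _](gtr0_norm hh) -normrM -normrN.
  rewrite [X in `|X| <= _](_ : _ = phi (h + t) - phi t + h * (gam t - phi t))//.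
  by field; rewrite gt_eqF.
Qed.

Let phi_right : phi s @[s --> 0^'+] --> phi 0.
Proof.
apply/cvgrPdist_le => e e0; have [d d0 H] := phi_small e0.
exists d => // s /=; rewrite distrC => sd s0; rewrite distrC.
by apply: H => //; exact: ltW.
Qed.

Let phi_left (t : R) : 0 < t -> phi s @[s --> t^'-] --> phi t.
Proof.
move=> t0; apply/cvgrPdist_le => e e0; have [d d0 H] := phi_small e0.
exists (Num.min d t); first by rewrite /= lt_min d0.
move=> s /=; rewrite lt_min => /andP[sd sdt] st; apply: H => //; last exact: ltW.
by move: sdt; rewrite gtr0_norm ?subr_gt0//; lra.
Qed.

(** Since phi' = phi - gam, the function - exp(-s) phi(s) is a primitive of exp(-s) gam(s). The time
    S stays finite; the boundary term at S is estimated separately in each application. *)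
Lemma resolvent_formula (S : R) : 0 < S ->
  (\int[lebesgue_measure]_(s in `[0%R, S]) (expR (- s) * gam s)%:E =
   (phi 0 - expR (- S) * phi S)%:E)%E.
Proof.
move=> S0; pose F := fun s => - (expR (- s) * phi s).
have dE (t : R) : is_derive t 1 (fun s : R => expR (- s)) (- expR (- t)).
  by apply: is_derive_eq; rewrite /GRing.scale/=; ring.
have dF (t : R) : 0 < t -> is_derive t 1 F (expR (- t) * gam t).
  move=> t0; have := phi_derive t0 => dphi; rewrite /F.
  by apply: is_derive_eq; rewrite /GRing.scale/=; ring.
have Econt : continuous (fun s : R => expR (- s)).
  by move=> y; apply: continuous_comp; [exact: opp_continuous|exact: continuous_expR].
rewrite (@continuous_FTC2 _ _ F 0 S S0).
- by rewrite /F oppr0 expR0 mul1r -EFinB opprK addrC.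
- move=> x; apply: cvgM; first exact: (continuous_subspaceT Econt).
  apply: continuous_subspaceW gam_cont x => y /=.
  by rewrite !in_itv/= andbT => /andP[].
- split.
  + by move=> t; rewrite in_itv/= => /andP[t0 _]; have [] := dF _ t0.
  + apply: cvgN; apply: cvgM; last exact: phi_right.
    by apply: cvg_at_right_filter; exact: Econt.
  + apply: cvgN; apply: cvgM; last exact: phi_left.
    by apply: cvg_at_left_filter; exact: Econt.
- move=> t; rewrite in_itv/= => /andP[t0 _]; by rewrite derive1E; have [_ ->] := dF _ t0.
Qed.
End ResolventFormula.

(** * The semigroup on L^2 and on L^oo, and excessivity and decay of the resolvent *)

Section Semigroup.
Context {R : realType} {X : pmetricType R}.
Variable m : {measure set (borel X) -> \bar R}.
Hypothesis m_gt0 : (0 < m [set: X])%E.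
Variables (F : set (X -> R)) (E : (X -> R) -> (X -> R) -> R).
Variable T : R -> (X -> R) -> X -> R.
Hypothesis T_L2 : is_L2_semigroup m F E T.
Hypothesis T_Linfty : is_Linfty_semigroup m T.
(** Discharged by the representation of [T] through the process. *)
Hypothesis T_pos : forall t f, 0 < t -> f \in Lfun m 2%:E ->
  (forall x, 0 <= f x) -> \forall x \ae m, 0 <= T t f x.
Implicit Types u v f g w : X -> R.

(** Compatibility with a.e. equality comes from linearity and contractivity: the norm of T_t(g - f)
    is at most that of g - f, which is 0. *)
Lemma semigroup_ae t f g : 0 <= t -> f \in Lfun m 2%:E -> g \in Lfun m 2%:E ->
  f = g %[ae m] -> T t f = T t g %[ae m].
Proof.
move=> t0 f2 g2 fg.
have d2 := Lfun2_lin (-1) f2 g2.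
have Td2 := L2sg_L2 T_L2 t0 d2.
have n0 : norm2 m (T t (fun x => -1 * f x + g x)) = 0.
  apply/eqP; rewrite eq_le norm2_ge0 andbT -(norm2_0 m).
  rewrite -(@norm2_ae _ _ m (fun x => -1 * f x + g x) (fun=> 0)).
  - exact: L2sg_contraction T_L2 _ _ t0 d2.
  - by move: fg; apply: aeS => x /(_ I) -> _; rewrite mulN1r addNr.
  - exact: Lfun_measurable d2.
  - exact: measurable_cst.
have Td0 := norm2_eq0 Td2 n0.
apply: (aeS2 _ (L2sg_linear T_L2 (-1) t0 f2 g2) Td0) => x.
move=> /(_ I) -> /(_ I) + _; rewrite mulN1r => /eqP.
by rewrite addrC subr_eq0 => /eqP ->.
Qed.

Lemma semigroup_mono t f g : 0 < t -> f \in Lfun m 2%:E -> g \in Lfun m 2%:E ->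
  (\forall x \ae m, f x <= g x) -> \forall x \ae m, T t f x <= T t g x.
Proof.
move=> t0 f2 g2 fg; have t0' := ltW t0.
have d2 := Lfun2_lin (-1) f2 g2.
(* [T_pos] asks for a function that is nonnegative everywhere, and g - f is so only a.e.; its
   absolute value is a version that is. *)
have p2 : (fun x => `|-1 * f x + g x|) \in Lfun m 2%:E.
  apply: (Lfun2_le _ d2); last by apply: ae_all => x; rewrite normr_id.
  by apply: measurableT_comp => //; exact: Lfun_measurable d2.
have dp :
    (fun x => -1 * f x + g x) = (fun x => `|-1 * f x + g x|) %[ae m].
  by move: fg; apply: aeS => x fg _; rewrite mulN1r addrC ger0_norm ?subr_ge0.
have e := semigroup_ae t0' d2 p2 dp.
have p := T_pos t0 p2 (fun x => normr_ge0 _).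
apply: (aeS3 _ (L2sg_linear T_L2 (-1) t0' f2 g2) e p) => x.
by move=> /(_ I) lE /(_ I) <-; rewrite lE mulN1r addrC subr_ge0.
Qed.

Lemma semigroup_scale t (c : R) f : 0 <= t -> f \in Lfun m 2%:E ->
  T t (fun x => c * f x) = (fun x => c * T t f x) %[ae m].
Proof.
(* Linearity with coefficient -1 and twice the same function yields T_t 0 = 0 a.e. *)
move=> t0 f2; have T0 := L2sg_linear T_L2 (-1) t0 f2 f2.
rewrite (_ : (fun x : X => -1 * f x + f x) = fun=> 0) in T0; last first.
  by apply/funext => x; rewrite mulN1r addNr.
have := L2sg_linear T_L2 c t0 f2 (Lfun2_0 m).
rewrite (_ : (fun x : X => c * f x + 0) = fun x => c * f x); last first.
  by apply/funext => x; rewrite addr0.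
by move: T0; apply: aeS2 => x /(_ I) e0 /(_ I) ->; rewrite e0 mulN1r addNr addr0.
Qed.

Lemma semigroup_ge0 t f : 0 <= t -> f \in Lfun m 2%:E ->
  (\forall x \ae m, 0 <= f x) -> \forall x \ae m, 0 <= T t f x.
Proof.
move=> t0 f2 f0; move: (t0); rewrite le_eqVlt => /orP[/eqP <-|t1].
  by apply: (aeS2 _ f0 (L2sg_0 T_L2 f2)) => x f0x /(_ I) ->.
have fT := semigroup_mono t1 (Lfun2_0 m) f2 f0.
have := semigroup_scale 0 t0 f2.
rewrite (_ : (fun x : X => 0 * f x) = fun=> 0); last first.
  by apply/funext => x; rewrite mul0r.
by move: fT; apply: aeS2 => x h /(_ I) e; rewrite e mul0r in h.
Qed.

Lemma semigroup_norm_le t f (c : R) : 0 <= t -> f \in Lfun m +oo%E ->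
  (\forall x \ae m, `|f x| <= c) -> \forall x \ae m, `|T t f x| <= c.
Proof.
move=> t0 foo fc; apply/LnormyP => //.
apply: (le_trans (Linfsg_contraction T_Linfty t0 foo)).
exact/LnormyP.
Qed.

Lemma inner_semigroup_lin t (c : R) f g h : 0 <= t -> f \in Lfun m 2%:E ->
  g \in Lfun m 2%:E -> h \in Lfun m 2%:E ->
  inner m (T t (fun x => c * f x + g x)) h =
  c * inner m (T t f) h + inner m (T t g) h.
Proof.
move=> t0 f2 g2 h2; have [Tf2 Tg2] := (L2sg_L2 T_L2 t0 f2, L2sg_L2 T_L2 t0 g2).
rewrite -inner_linl//; apply: inner_ae; last exact: (L2sg_linear T_L2).
- exact: Lfun_measurable (L2sg_L2 T_L2 t0 (Lfun2_lin _ f2 g2)).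
- exact: Lfun_measurable (Lfun2_lin _ Tf2 Tg2).
- exact: Lfun_measurable h2.
Qed.

Section Resolvent.
Variables (u w : X -> R).
Hypothesis uw : form_operator m F E u (fun x => w x - u x).
Hypothesis u2 : u \in Lfun m 2%:E.
Hypothesis w2 : w \in Lfun m 2%:E.
Hypothesis woo : w \in Lfun m +oo%E.

(** The hypothesis [uw] says H u = w - u, so the error q_h = (u - T_h u)/h - (w - u) tends to 0 in
    L^2. The semigroup law turns the increment of <T_t u, 1_D> from a to a + h, corrected by its
    linear part, into - h <T_a q_h, 1_D>; contractivity bounds this uniformly in a. Boundedness of w
    and integrability of 1_D give continuity of <T_t w, 1_D>. *)
Lemma resolvent_inner (D : set X) (S : R) : borel_set X D -> (m D < +oo)%E ->
  0 < S ->
  (\int[lebesgue_measure]_(s in `[0%R, S]) (expR (- s) * inner m (T s w) \1_D)%:E =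
   (inner m u \1_D - expR (- S) * inner m (T S u) \1_D)%:E)%E.
Proof.
move=> mD Df S0; have [D2 D1] := Lfun_indic mD Df.
have v2 : (fun x => w x - u x) \in Lfun m 2%:E by exact: Lfun2_sub.
pose q h x := h^-1 * (u x - T h u x) - (w x - u x).
have u0 : inner m u \1_D = inner m (T 0 u) \1_D.
  apply: inner_ae; [exact: Lfun_measurable u2| | exact: measurable_indic | ].
    exact: Lfun_measurable (L2sg_L2 T_L2 (lexx 0) u2).
  by apply: (aeS _ (L2sg_0 T_L2 u2)) => x /(_ I) ->.
rewrite u0; apply: (@resolvent_formula _ (fun t => inner m (T t u) \1_D)
  (fun t => inner m (T t w) \1_D) (fun h => norm2 m (q h) * norm2 m \1_D)
  (norm2 m (fun x => w x - u x) * norm2 m \1_D)) => //.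
- rewrite -[X in _ --> X](mul0r (norm2 m \1_D)); apply: cvgM; last exact: cvg_cst.
  exact/(L2sg_generator T_L2 u2 v2).
- move=> a b a0 ab; set h := b - a.
  have h0 : 0 < h by rewrite subr_gt0.
  have b0 : 0 <= b by exact: le_trans (ltW ab).
  have Thu2 := L2sg_L2 T_L2 (ltW h0) u2.
  have Tau2 := L2sg_L2 T_L2 a0 u2.
  have Taw2 := L2sg_L2 T_L2 a0 w2.
  have Tbu2 := L2sg_L2 T_L2 b0 u2.
  have q2 : q h \in Lfun m 2%:E.
    by apply: Lfun2_sub => //; apply: Lfun2_scale; exact: Lfun2_sub.
  have Taq2 := L2sg_L2 T_L2 a0 q2.
  have -> : inner m (T b u) \1_D - inner m (T a u) \1_D +
      h * (inner m (T a w) \1_D - inner m (T a u) \1_D) =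
      - h * inner m (T a (q h)) \1_D.
    have e : inner m (T b u) \1_D = inner m (T a (T h u)) \1_D.
      apply: inner_ae; [exact: Lfun_measurable Tbu2| | exact: measurable_indic |].
        exact: Lfun_measurable (L2sg_L2 T_L2 a0 Thu2).
      by have := L2sg_add T_L2 a0 (ltW h0) u2; rewrite /h addrC subrK.
    rewrite e.
    have -> : q h = fun x => -h^-1 * T h u x + (h^-1 * u x + (-1 * w x + u x)).
      by apply/funext => x; rewrite /q; ring.
    have wu2 := Lfun2_lin (-1) w2 u2.
    have uwu2 := Lfun2_lin h^-1 u2 wu2.
    rewrite !inner_semigroup_lin//.
    by field; rewrite gt_eqF.
  rewrite normrM normrN (gtr0_norm h0) ler_pM2l//.
  apply: (le_trans (inner_le Taq2 D2)); rewrite ler_wpM2r ?norm2_ge0//.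
  exact: L2sg_contraction T_L2 _ _ a0 q2.
- move=> a a0.
  have -> : inner m (T a w) \1_D - inner m (T a u) \1_D =
      inner m (T a (fun x => w x - u x)) \1_D.
    rewrite (_ : (fun x => w x - u x) = fun x => -1 * u x + w x).
      by rewrite inner_semigroup_lin// mulN1r addrC.
    by apply/funext => x; rewrite mulN1r addrC.
  apply: (le_trans (inner_le (L2sg_L2 T_L2 a0 v2) D2)).
  by rewrite ler_wpM2r ?norm2_ge0//; exact: L2sg_contraction T_L2 _ _ a0 v2.
- exact: Linfsg_weak_star_time T_Linfty _ _ woo D1.
Qed.

(** Tested against 1_D, u - exp(-t) T_t u is the integral of exp(-s) <T_s w, 1_D> over [0, t], which
    is nonnegative. *)
Lemma resolvent_excessive : (\forall x \ae m, 0 <= w x) -> one_excessive m T u.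
Proof.
move=> w0 t t0; have t0' := ltW t0.
have Tu2 := L2sg_L2 T_L2 t0' u2.
have eTu2 := Lfun2_scale (expR (- t)) Tu2.
suff H : \forall x \ae m, [set: X] x -> -1 * u x + expR (- t) * T t u x <= 0.
  by move: H; apply: aeS => x /(_ I); rewrite mulN1r addrC subr_le0.
apply: ae_le_test => //; first exact: Lfun2_lin.
move=> D mD _ Df; have [D2 _] := Lfun_indic mD Df.
rewrite mul0r inner_linl// inner_scale// mulN1r addrC subr_le0.
rewrite -subr_ge0 -lee_fin -resolvent_inner//.
apply: integral_ge0 => s; rewrite /= in_itv/= => /andP[s0 _].
rewrite lee_fin mulr_ge0 ?expR_ge0//.
rewrite -(inner_0 m \1_D).
apply: inner_mono => //; [exact: Lfun2_0|exact: (L2sg_L2 T_L2)|].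
exact: semigroup_ge0.
Qed.

Let small_exp (e : R) : 0 < e -> exists2 S : R, 0 < S & expR (- S) <= e.
Proof.
move=> e0; exists e^-1; first by rewrite invr_gt0.
rewrite expRN invf_ple ?posrE ?expR_gt0//.
by apply: le_trans (expR_ge1Dx _); rewrite lerDr.
Qed.

(** The constants phi = gam = 1 solve phi' = phi - gam. *)
Let integral_expRN (S : R) : 0 < S ->
  (\int[lebesgue_measure]_(s in `[0%R, S]) (expR (- s))%:E = (1 - expR (- S))%:E)%E.
Proof.
move=> S0; have := @resolvent_formula R (fun=> 1) (fun=> 1) (fun=> 0) 0.
move=> /(_ (cvg_cst _)) H; have := H _ _ _ S S0.
under eq_integral do rewrite mulr1.
rewrite mulr1; apply.
- by move=> a b _ _; rewrite !subrr !mulr0 addr0 normr0.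
- by move=> a _; rewrite subrr normr0.
- by apply: continuous_subspaceT => x; exact: cvg_cst.
Qed.

Let inner_gam_cont (D : set X) : borel_set X D -> (m D < +oo)%E ->
  {within `[0, +oo[, continuous (fun s => inner m (T s w) \1_D)}.
Proof.
move=> mD Df; have [_ D1] := Lfun_indic mD Df.
exact: Linfsg_weak_star_time T_Linfty _ _ woo D1.
Qed.

Let expRN_measurable (D : set R) : measurable_fun D (fun s : R => expR (- s)).
Proof. by apply: measurableT_comp => //; exact: measurable_expR. Qed.

Let integrand_measurable (D : set X) (S : R) : borel_set X D -> (m D < +oo)%E ->
  measurable_fun `[0, S] (fun s => expR (- s) * inner m (T s w) \1_D).
Proof.
move=> mD Df; apply: subspace_continuous_measurable_fun => // x.
apply: cvgM.
  have Econt : continuous (fun s : R => expR (- s)).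
    by move=> y; apply: continuous_comp; [exact: opp_continuous|exact: continuous_expR].
  exact: (continuous_subspaceT Econt).
apply: continuous_subspaceW (inner_gam_cont mD Df) x => y /=.
by rewrite !in_itv/= andbT => /andP[].
Qed.

(** The integral over [0, S] contributes at most c m(D). As u is not yet known to be bounded, the
    term at time S is controlled only by L^2 norms, hence depending on D; this is harmless because S
    is chosen after D. *)
Let resolvent_bound (c : R) : (\forall x \ae m, `|w x| <= c) ->
  \forall x \ae m, `|u x| <= c.
Proof.
move=> wc; have c0 : 0 <= c.
  by have [x] := ae_ex m_gt0 wc; exact: le_trans.
suff H : \forall x \ae m, [set: X] x -> `|u x| <= c.
  by move: H; apply: aeS => x; exact.
apply: ae_norm_le_test => // D mD _ Df; have [D2 _] := Lfun_indic mD Df.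
apply/ler_addgt0Pr => e e0.
pose A := norm2 m u * norm2 m \1_D.
have A1 : 0 < A + 1 by rewrite ltr_wpDl// mulr_ge0 ?norm2_ge0.
have [S S0 eS] := small_exp (divr_gt0 e0 A1).
rewrite -[inner m u \1_D](subrK (expR (- S) * inner m (T S u) \1_D)).
apply: (le_trans (ler_normD _ _)); apply: lerD; last first.
  rewrite normrM (gtr0_norm (expR_gt0 _)).
  apply: (@le_trans _ _ (e / (A + 1) * A)); last first.
    by rewrite -mulrA ger_pMr// mulrC ler_pdivrMr// mul1r lerDl.
  apply: ler_pM => //.
  apply: (le_trans (inner_le (L2sg_L2 T_L2 (ltW S0) u2) D2)).
  by rewrite ler_wpM2r ?norm2_ge0//; exact: L2sg_contraction T_L2 _ _ (ltW S0) u2.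
rewrite -lee_fin -abse_EFin -resolvent_inner//.
have mI := @integrand_measurable _ S mD Df.
apply: (le_trans (le_abse_integral _ _ _)) => //; first exact/measurable_EFinP.
apply: (@le_trans _ _ (\int[lebesgue_measure]_(s in `[0%R, S])
    ((c * fine (m D))%:E * (expR (- s))%:E))%E).
  apply: ge0_le_integral => //.
  - by apply: measurableT_comp => //; exact/measurable_EFinP.
  - by apply: emeasurable_funM => //; apply/measurable_EFinP; exact: expRN_measurable.
  - move=> s; rewrite /= in_itv/= => /andP[s0 _].
    rewrite -EFinM lee_fin normrM (gtr0_norm (expR_gt0 _)) mulrC ler_wpM2r ?expR_ge0//.
    apply: inner_indic_le => //; first exact: (L2sg_L2 T_L2).
    by move: (semigroup_norm_le s0 woo wc); apply: aeS => x + _.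
rewrite ge0_integralZl//.
- rewrite integral_expRN// -EFinM lee_fin ler_piMr ?mulr_ge0 ?fine_ge0//.
- by apply/measurable_EFinP; exact: expRN_measurable.
- by rewrite lee_fin mulr_ge0 ?fine_ge0.
Qed.

Let integral_two_level (g : R -> R) (B : set R) (a b S : R) : 0 < S ->
  measurable B -> measurable_fun `[0, S] g -> 0 <= a -> 0 <= b ->
  (forall s, 0 < s -> s <= S -> `|g s| <= a + b * \1_B s) ->
  (`|\int[lebesgue_measure]_(s in `[0%R, S]) (g s)%:E| <=
     (a * S)%:E + b%:E * lebesgue_measure B)%E.
Proof.
move=> S0 mB mg a0 b0 gB.
have mg' : measurable_fun `]0, S] g.
  by apply: measurable_funS mg => //; apply: subset_itvr; rewrite bnd_simp.
(* The bound on [g] is assumed for positive times only. *)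
rewrite -integral_itv_obnd_cbnd; last exact/measurable_EFinP.
apply: (le_trans (le_abse_integral _ _ _)) => //; first exact/measurable_EFinP.
apply: (@le_trans _ _ (\int[lebesgue_measure]_(s in `]0%R, S])
    (a%:E + b%:E * (\1_B s)%:E))%E).
  apply: ge0_le_integral => //.
  - by apply: measurableT_comp => //; exact/measurable_EFinP.
  - apply: emeasurable_funD => //; apply: emeasurable_funM => //.
    by apply/measurable_EFinP; exact: measurable_indic.
  - by move=> s; rewrite /= in_itv/= => /andP[s0 sS]; rewrite -EFinM -EFinD lee_fin gB.
rewrite ge0_integralD//; last 2 first.
- by move=> s _; rewrite -EFinM lee_fin mulr_ge0.
- by apply: emeasurable_funM => //; apply/measurable_EFinP; exact: measurable_indic.
have lS : lebesgue_measure (`]0%R, S]%classic : set R) = S%:E.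
  by rewrite lebesgue_measure_itv/= lte_fin S0 sube0.
rewrite integral_cst// [X in (_ * X + _)%E]lS -EFinM.
rewrite leeD2l// ge0_integralZl//; last by apply/measurable_EFinP; exact: measurable_indic.
rewrite integral_indic// lee_wpmul2l ?lee_fin//.
by apply: le_measure; rewrite ?inE//; exact: measurableI.
Qed.

(** Three errors of size (e/3) m(D) are added: the times outside [B n] give at most S (e/3/S) m(D),
    the times in [B n] at most c m(D) times the length of [B n], and the term at time S at most
    exp(-S) c m(D). Both S and n are fixed before D, so the estimate is uniform in D. The window ]0,
    S + 1[ is open and still contains S. *)
Lemma resolvent_Linfty0 : locally_compact [set: X] -> separable_space X ->
  Linfty0_diffusion m T -> Linfty0 m w -> Linfty0 m u.
Proof.
move=> lcX sX Tdiff w0.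
have [L [cL Lmono Lnbhs]] := compact_exhaustion lcX sX.
have mL n : borel_set X (~` L n) by apply: measurableC; exact: borel_compact.
have /Linfty0P-/(_ m_gt0)[_ [c wc] _] := w0.
have c0 : 0 <= c by have [x] := ae_ex m_gt0 wc; exact: le_trans.
have uc := resolvent_bound wc.
have mu := Lfun_measurable u2.
have uoo : u \in Lfun m +oo%E by apply/LfunyP => //; split=> //; exists c.
apply/Linfty0P => //; split=> //; first by exists c.
move=> e e0; have e30 : 0 < e / 3 by rewrite divr_gt0.
have e30' := ltW e30.
have c10 : 0 < c + 1 by rewrite ltr_wpDl.
have ec0 : 0 < e / 3 / (c + 1) by rewrite divr_gt0.
have [S S0 eS] := small_exp ec0.
have eS0 : 0 < e / 3 / S by rewrite divr_gt0.
(* s |-> T_s w is only weak-* continuous; testing against indicators makes B n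
   open. *)
pose B n := `]0, S + 1[%classic `&` [set s | exists D, [/\ borel_set X D,
  D `<=` ~` L n, (m D < +oo)%E & e / 3 / S * fine (m D) < `|inner m (T s w) \1_D|]].
have oB n : open (B n).
  rewrite openE => s [/= sS [D [mD DL Df sD]]].
  have /continuous_within_itvcyP[gc _] := inner_gam_cont mD Df.
  have s_in : s \in `]0, +oo[ by move: sS; rewrite !in_itv/= andbT => /andP[].
  have ngc : {for s, continuous (fun s => `|inner m (T s w) \1_D|)}.
    by apply: continuous_comp; [exact: gc|exact: norm_continuous].
  rewrite /interior/=; near=> s'; split.
    by near: s'; apply: open_nbhs_nbhs; split=> //; exact: itv_open.
  exists D; split=> //; near: s'; exact: (ngc _ (lt_nbhsr sD)).
have mB n : measurable (B n) by exact: open_measurable.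
(* For each single s > 0 the diffusion property gives a compact set off which |T_s w| is at most
   e/3/S; some [L n] contains it, and then s is not in [B n]. *)
have B0 : \bigcap_n B n = set0.
  rewrite -subset0 => s /= Bs.
  have [/= sS _] := Bs 0%N I.
  have s0 : 0 < s by move: sS; rewrite in_itv/= => /andP[].
  have /Linfty0P-/(_ m_gt0)[_ _ /(_ _ eS0)[K cK sK]] := Tdiff s w s0 w0.
  have [n KL] := exhaustion_absorbs Lmono Lnbhs cK.
  have [_ [D [mD DL Df]]] := Bs n I; rewrite ltNge => /negP; apply.
  apply: inner_indic_le => //; [exact: ltW|exact: (L2sg_L2 T_L2 (ltW s0) w2)|].
  move: sK; apply: aeS => x + /DL Lx; apply => /KL/interior_subset; exact: Lx.
have [n Bn] : exists n, (lebesgue_measure (B n) < (e / 3 / (c + 1))%:E)%E.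
  have B0fin : (lebesgue_measure (B 0%N) < +oo)%E.
    apply: (@le_lt_trans _ _ (lebesgue_measure (`]0, S + 1[%classic : set R))).
      apply: le_measure; rewrite ?inE; [exact: mB|exact: measurable_itv|exact: subIsetl].
    by rewrite lebesgue_measure_itv/= lte_fin ltr_wpDl ?ltW// sube0 ltry.
  have mB0 : measurable (\bigcap_n B n) by rewrite B0.
  have Bmono : {homo B : n k / (n <= k)%N >-> (k <= n)%O}.
    move=> i j ij; rewrite subsetEset => s [sS [D [mD DL Df sD]]]; split=> //.
    by exists D; split=> //; apply: subset_trans DL _; apply: subsetC; exact: Lmono.
  have := nonincreasing_cvg_mu B0fin mB mB0 Bmono; rewrite B0 measure0 => H.
  have [] := H [set y | (y < (e / 3 / (c + 1))%:E)%E].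
    by apply: open_nbhs_nbhs; split; [exact: open_ereal_lt_ereal|rewrite /= lte_fin].
  by move=> n _ /(_ n (leqnn n)) /= ?; exists n.
exists (L n) => //.
apply: (@ae_norm_le_test _ _ m u (~` L n)) => //; first exact: ltW.
move=> D mD DL Df; have [D2 _] := Lfun_indic mD Df.
have D0 : 0 <= fine (m D) by rewrite fine_ge0.
rewrite -[inner m u \1_D](subrK (expR (- S) * inner m (T S u) \1_D)).
apply: (le_trans (ler_normD _ _)).
have A0 : e / 3 / (c + 1) * (c * fine (m D)) <= e / 3 * fine (m D).
  rewrite mulrA ler_wpM2r// -[leRHS]mulr1 -mulrA ler_wpM2l//.
  by rewrite mulrC ler_pdivrMr// mul1r lerDl.
have A1 : `|expR (- S) * inner m (T S u) \1_D| <= e / 3 * fine (m D).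
  rewrite normrM (gtr0_norm (expR_gt0 _)).
  apply: (@le_trans _ _ (e / 3 / (c + 1) * (c * fine (m D)))).
    apply: ler_pM => //; apply: inner_indic_le => //.
      exact: (L2sg_L2 T_L2 (ltW S0)).
    by move: (semigroup_norm_le (ltW S0) uoo uc); apply: aeS => x + _.
  exact: A0.
have A2 : `|inner m u \1_D - expR (- S) * inner m (T S u) \1_D| <=
    e / 3 * fine (m D) + e / 3 * fine (m D).
  rewrite -lee_fin -abse_EFin -resolvent_inner//.
  have gB s : 0 < s -> s <= S -> `|expR (- s) * inner m (T s w) \1_D| <=
      e / 3 / S * fine (m D) + (c * fine (m D)) * \1_(B n) s.
    move=> s0 sS; rewrite normrM (gtr0_norm (expR_gt0 _)).
    have e1 : expR (- s) <= 1 by rewrite -expR0 ler_expR oppr_le0 ltW.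
    apply: (@le_trans _ _ `|inner m (T s w) \1_D|); first by rewrite ler_piMl.
    rewrite indicE; case: (boolP (s \in B n)) => [_|].
      rewrite mulr1; apply: ler_wpDl; first by rewrite mulr_ge0// ltW.
      apply: inner_indic_le => //; first exact: (L2sg_L2 T_L2 (ltW s0)).
      by move: (semigroup_norm_le (ltW s0) woo wc); apply: aeS => x + _.
    rewrite notin_setE => nBs; rewrite mulr0 addr0 leNgt; apply/negP => sD; apply: nBs.
    split; last by exists D.
    by rewrite /= in_itv/= s0/= (le_lt_trans sS)// ltrDl.
  have mI := @integrand_measurable _ S mD Df.
  apply: (le_trans (integral_two_level S0 (mB n) mI _ _ gB)).
  - by rewrite mulr_ge0// ltW.
  - by rewrite mulr_ge0.
  rewrite EFinD leeD//.
    by rewrite lee_fin mulrAC divfK// gt_eqF.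
  apply: (@le_trans _ _ ((c * fine (m D))%:E * (e / 3 / (c + 1))%:E)%E).
    by rewrite lee_wpmul2l ?lee_fin ?mulr_ge0// ltW.
  by rewrite -EFinM lee_fin mulrC.
have -> : e * fine (m D) =
    (e / 3 * fine (m D) + e / 3 * fine (m D)) + e / 3 * fine (m D).
  by field.
exact: lerD.
Unshelve. all: by end_near. Qed.

End Resolvent.

(** Split f at a compact K off which |f| <= e/2. The outer part is small in L^oo and remains so by
    contractivity; the inner part lies in L^2 and is dominated by c 1_K, so monotonicity on L^2
    bounds its image by c T_t 1_K. *)
Lemma diffusion_of_compact_bound :
  (forall K : set X, compact K -> (m K < +oo)%E) ->
  (forall t K, 0 < t -> compact K -> exists v (c : R), Linfty0 m v /\
     \forall x \ae m, `|T t \1_K x| <= c * `|v x|) ->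
  Linfty0_diffusion m T.
Proof.
move=> mfin Tdom t f t0 f0; have t0' := ltW t0.
have /Linfty0P-/(_ m_gt0)[mf [c fc] fsmall] := f0.
have c0 : 0 <= c by have [x] := ae_ex m_gt0 fc; exact: le_trans.
have foo : f \in Lfun m +oo%E by apply/LfunyP => //; split=> //; exists c.
have Tfoo := Linfsg_Linf T_Linfty t0' foo.
have /LfunyP-/(_ m_gt0)[mTf Tfb] := Tfoo.
apply/Linfty0P => //; split=> // e e0.
have e20 : 0 < e / 2 by rewrite divr_gt0.
have [K cK Ke] := fsmall _ e20.
have mK : borel_set X K by exact: borel_compact.
have [K2 _] := Lfun_indic mK (mfin K cK).
pose f1 x := f x * \1_K x.
pose f2 x := f x * \1_(~` K) x.
have mf1 : measurable_fun [set: borel X] f1.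
  by apply: measurable_funM => //; exact: measurable_indic.
have mf2 : measurable_fun [set: borel X] f2.
  by apply: measurable_funM => //; apply: measurable_indic; exact: measurableC.
have f1c : \forall x \ae m, `|f1 x| <= c * \1_K x.
  move: fc; apply: aeS => x fx; rewrite /f1 indicE.
  by case: (x \in K); rewrite ?mulr1// !mulr0 normr0.
have f2e : \forall x \ae m, `|f2 x| <= e / 2.
  move: Ke; apply: aeS => x fx; rewrite /f2 indicE in_setC.
  case: (boolP (x \in K)) => [_|]; first by rewrite mulr0 normr0 ltW.
  by rewrite notin_setE mulr1 => /fx.
have f2oo : f2 \in Lfun m +oo%E by apply/LfunyP => //; split=> //; exists (e / 2).
have f1oo : f1 \in Lfun m +oo%E.
  apply/LfunyP => //; split=> //; exists c; move: f1c; apply: aeS => x h.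
  by apply: (le_trans h); rewrite indicE; case: (x \in K); rewrite ?mulr1// mulr0.
have cK2 : (fun x => c * \1_K x) \in Lfun m 2%:E by exact: Lfun2_scale.
have f1L2 : f1 \in Lfun m 2%:E.
  apply: (Lfun2_le mf1 cK2); move: f1c; apply: aeS => x h.
  by apply: (le_trans h); exact: ler_norm.
have fE : f = (fun x => 1 * f1 x + f2 x).
  apply/funext => x; rewrite mul1r /f1 /f2 !indicE in_setC.
  by case: (x \in K); rewrite ?mulr1 mulr0 ?addr0 ?add0r.
have TfE := Linfsg_linear T_Linfty 1 t0' f1oo f2oo; rewrite -fE in TfE.
have Tf2 := semigroup_norm_le t0' f2oo f2e.
have Tf1 : \forall x \ae m, `|T t f1 x| <= c * T t \1_K x.
  have up : \forall x \ae m, T t f1 x <= T t (fun x => c * \1_K x) x.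
    apply: semigroup_mono => //; move: f1c; apply: aeS => x h.
    by apply: (le_trans _ h); exact: ler_norm.
  have lo : \forall x \ae m, T t (fun x => -1 * f1 x) x <= T t (fun x => c * \1_K x) x.
    apply: semigroup_mono => //; first exact: Lfun2_scale.
    move: f1c; apply: aeS => x h.
    by apply: (le_trans _ h); rewrite mulN1r -normrN; exact: ler_norm.
  have e1 := semigroup_scale c t0' K2.
  have e2 := semigroup_scale (-1) t0' f1L2.
  have both : \forall x \ae m, T t f1 x <= c * T t \1_K x /\
      T t (fun x => -1 * f1 x) x <= c * T t \1_K x.
    by move: e1 up lo; apply: aeS3 => x /(_ I) <-.
  move: both e2; apply: aeS2 => x [h1 h2] /(_ I) e2.
  by rewrite ler_norml h1 andbT lerNl -mulN1r -e2.
have [v [b [/Linfty0P-/(_ m_gt0)[_ _ vsmall] Kv]]] := Tdom t K t0 cK.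
have b0 : 0 < c * `|b| + 1 by rewrite ltr_wpDl// mulr_ge0.
have [L cL Lv] := vsmall _ (divr_gt0 e20 b0).
exists L => //.
have Tf1v : \forall x \ae m, ~ L x -> `|T t f1 x| <= e / 2.
  move: Tf1 Kv Lv; apply: aeS3 => x h1 h2 h3 nLx; apply: (le_trans h1).
  apply: (@le_trans _ _ (c * (`|b| * (e / 2 / (c * `|b| + 1))))).
    rewrite ler_wpM2l//; apply: (le_trans (ler_norm _)); apply: (le_trans h2).
    apply: (@le_trans _ _ (`|b| * `|v x|)); first by rewrite ler_wpM2r// ler_norm.
    by rewrite ler_wpM2l// h3.
  rewrite (_ : c * _ = e / 2 * (c * `|b| / (c * `|b| + 1))); last by ring.
  by rewrite ler_piMr ?(ltW e20)// ler_pdivrMr// mul1r lerDl.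
move: Tf1v Tf2 TfE; apply: aeS3 => x h1 h2 /(_ I) -> nLx.
rewrite mul1r (le_trans (ler_normD _ _))// [leRHS]splitr lerD//.
exact: h1.
Qed.

End Semigroup.

(** * Induction over nonnegative measurable functions *)

Section NonnegMeasurableInduction.
Import HBNNSimple.
Context d (S : measurableType d) (R : realType).
Local Open Scope ereal_scope.

(** Passage from indicators over simple functions to increasing limits. It serves for the
    measurability of transition functions and for the Markov property. *)
Lemma ge0_measurable_ind (Q : (S -> \bar R) -> Prop) :
  (forall A, measurable A -> Q (fun x => (\1_A x)%:E)) ->
  (forall (c : R) f, (0 <= c)%R -> (forall x, 0 <= f x) ->
     measurable_fun [set: S] f -> Q f -> Q (fun x => c%:E * f x)) ->
  (forall f g, (forall x, 0 <= f x) -> (forall x, 0 <= g x) ->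
     measurable_fun [set: S] f -> measurable_fun [set: S] g ->
     Q f -> Q g -> Q (fun x => f x + g x)) ->
  (forall (f_ : nat -> S -> \bar R), (forall n x, 0 <= f_ n x) ->
     (forall n, measurable_fun [set: S] (f_ n)) ->
     (forall x, {homo f_ ^~ x : n k / (n <= k)%N >-> n <= k}) ->
     (forall n, Q (f_ n)) -> Q (fun x => limn (f_ ^~ x))) ->
  forall f, (forall x, 0 <= f x) -> measurable_fun [set: S] f -> Q f.
Proof.
move=> Q1 QZ QD Qlim f f0 mf.
have Qs (h : {nnsfun S >-> R}) : Q (fun x => (h x)%:E).
  pose r : seq R := finmap.enum_fset (fset_set (range h)).
  (* The values of [h] are nonnegative. Writing them as [Num.max y 0] keeps this visible in an
     induction over an arbitrary list of reals. *)
  have hE : (fun x => (h x)%:E) = (fun x =>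
      \sum_(y <- r) (Num.max y 0%R)%:E * (\1_(h @^-1` [set y]) x)%:E).
    apply/funext => x; rewrite fimfunE -fsumEFin// fsbig_finite//=.
    apply: eq_big_seq => y; rewrite in_fset_set// inE /= => -[z _ <-].
    by rewrite EFinM; congr (_%:E * _); rewrite max_l.
  rewrite hE; move: r {hE} => r; elim: r => [|y r ih].
    under eq_fun do rewrite big_nil.
    rewrite (_ : (fun=> _) = fun x => (\1_set0 x)%:E); first exact: Q1.
    by apply/funext => x; rewrite indicE in_set0.
  under eq_fun do rewrite big_cons.
  have m1 (A : set S) : measurable A ->
      measurable_fun [set: S] (fun x => (\1_A x)%:E : \bar R).
    by move=> mA; apply/measurable_EFinP; exact: measurable_indic.
  have mh z : measurable (h @^-1` [set z]) by exact: measurable_funPTI.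
  have y0 (z : R) : (0 <= Num.max z 0)%R by rewrite le_max lexx orbT.
  have t0 (z : R) x : 0 <= (Num.max z 0%R)%:E * (\1_(h @^-1` [set z]) x)%:E.
    by rewrite -EFinM lee_fin mulr_ge0.
  have tm (z : R) : measurable_fun [set: S]
      (fun x => (Num.max z 0%R)%:E * (\1_(h @^-1` [set z]) x)%:E).
    by apply: emeasurable_funM => //; exact: m1.
  apply: QD => //.
  - by move=> x; apply: sume_ge0 => z _.
  - by apply: emeasurable_sum => z; exact: tm.
  - by apply: QZ => //; [exact: m1|exact: Q1].
pose f_ n := nnsfun_approx measurableT mf n.
have fE : f = fun x => limn (fun n => (f_ n x)%:E).
  apply/funext => x; apply/esym/cvg_lim => //.
  by apply: cvg_nnsfun_approx => // y _; exact: f0.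
rewrite fE; apply: Qlim => //.
- by move=> n x; rewrite lee_fin.
- by move=> n; apply/measurable_EFinP.
- move=> x n k nk; rewrite lee_fin; exact/lefP/nd_nnsfun_approx.
Qed.
End NonnegMeasurableInduction.

(** * Laplace transforms as limits of Riemann sums *)

Lemma squeeze_invS (R : realType) (G : nat -> R) (l : R) :
  (forall n, G n <= l <= G n + 2 * n.+1%:R^-1) -> G n @[n --> \oo] --> l.
Proof.
move=> Gl; apply/cvgrPdist_le => e e0.
have e20 : 0 < e / 2 by rewrite divr_gt0.
near=> n; have /andP[G1 G2] := Gl n.
rewrite ger0_norm ?subr_ge0// lerBlDl (le_trans G2)// lerD2l.
rewrite -ler_pdivlMl// mulrC.
near: n; have /ltr_add_invr[k] := e20; rewrite add0r => ke.
exists k => // n /= kn; apply: le_trans (ltW ke).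
by rewrite lef_pV2 ?posrE// ler_nat.
Unshelve. all: by end_near. Qed.

Section LaplaceTransform.
Context d (S : measurableType d) (R : realType).

Variables (mu : {measure set S -> \bar R}) (sigma : S -> \bar R).
Hypothesis sigma0 : forall w, (0 <= sigma w)%E.
Hypothesis msigma : forall t : R, 0 <= t -> measurable [set w | (sigma w <= t%:E)%E].

Let phi w : R := fine (expeR (- sigma w)).

Let phiE w : expeR (- sigma w) = (phi w)%:E.
Proof. by rewrite /phi; case: (sigma w) (sigma0 w) => [r| |]. Qed.

Let phi_ge t w : (sigma w <= t%:E)%E -> expR (- t) <= phi w.
Proof.
rewrite /phi; case: (sigma w) (sigma0 w) => [r| |]//= _.
by rewrite lee_fin ler_expR lerN2.
Qed.

Let phi_le t w : (t%:E <= sigma w)%E -> phi w <= expR (- t).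
Proof.
rewrite /phi; case: (sigma w) (sigma0 w) => [r| |]//= _.
by rewrite lee_fin ler_expR lerN2.
Qed.

(* A Riemann sum for exp (- sigma) = \int_sigma^oo exp (- t) dt. *)
Definition laplace_step (h : R) (M : nat) (w : S) : R :=
  \sum_(k < M) (expR (- (k%:R * h)) - expR (- (k.+1%:R * h))) *
    \1_[set w | (sigma w <= (k%:R * h)%:E)%E] w.

(** If j h is the first grid time at or after sigma and j <= M, the sum telescopes to exp(-j h) -
    exp(-M h), and a single step changes the exponential by at most h. If sigma > M h the sum
    vanishes and phi is at most exp(-M h). *)
Lemma laplace_step_bounds h M w : 0 < h ->
  laplace_step h M w <= phi w <= laplace_step h M w + (expR (- (M%:R * h)) + h).
Proof.
move=> h0.
have step (k : nat) : expR (- (k%:R * h)) - expR (- (k.+1%:R * h)) <= h.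
  have -> : expR (- (k.+1%:R * h)) = expR (- (k%:R * h)) * expR (- h).
    by rewrite -expRD -natr1; congr expR; ring.
  rewrite -[X in X - _]mulr1 -mulrBr.
  have e1 : expR (- (k%:R * h)) <= 1.
    by rewrite -expR0 ler_expR oppr_le0 mulr_ge0// ltW.
  have := expR_ge1Dx (- h) => e2.
  have e3 : 0 <= 1 - expR (- h) by rewrite subr_ge0 -expR0 ler_expR oppr_le0 ltW.
  apply: (@le_trans _ _ (1 * (1 - expR (- h)))); first by rewrite ler_wpM2r.
  by rewrite mul1r; lra.
suff [A B] : ((sigma w <= (M%:R * h)%:E)%E ->
     laplace_step h M w <= phi w - expR (- (M%:R * h)) /\
     phi w - expR (- (M%:R * h)) - h <= laplace_step h M w) /\
   (((M%:R * h)%:E < sigma w)%E -> laplace_step h M w = 0).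
  have [/A[A1 A2]|] := leP (sigma w) (M%:R * h)%:E.
    apply/andP; split; last by lra.
    by apply: (le_trans A1); rewrite lerBlDr lerDl expR_ge0.
  move=> Mw; rewrite (B Mw) add0r; apply/andP; split.
    by rewrite fine_ge0// expeR_ge0.
  by apply: (le_trans (phi_le (ltW Mw))); rewrite lerDl ltW.
have indicT (k : nat) : (sigma w <= (k%:R * h)%:E)%E ->
    \1_[set w | (sigma w <= (k%:R * h)%:E)%E] w = 1 :> R.
  by move=> kw; rewrite indicE mem_set.
have indicF (k : nat) : ((k%:R * h)%:E < sigma w)%E ->
    \1_[set w | (sigma w <= (k%:R * h)%:E)%E] w = 0 :> R.
  by move=> kw; rewrite indicE memNset//= leNgt kw.
have lt_step (k : nat) : k%:R * h <= k.+1%:R * h by rewrite ler_pM2r// ler_nat.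
elim: M => [|M [ihA ihB]]; rewrite /laplace_step.
  rewrite big_ord0 mul0r oppr0 expR0; split=> // s0.
  have p1 : 1 <= phi w by have := phi_ge s0; rewrite oppr0 expR0.
  have p2 : phi w <= 1 by have := phi_le (sigma0 w); rewrite oppr0 expR0.
  by split; lra.
rewrite big_ord_recr /= -/(laplace_step h M w); split=> sM.
  have [M1|M1] := leP (sigma w) (M%:R * h)%:E.
    by have [ih1 ih2] := ihA M1; rewrite indicT// mulr1; split; lra.
  rewrite ihB// indicF// mulr0 addr0; have := phi_ge sM; have := phi_le (ltW M1).
  by have := step M; split; lra.
have M1 : ((M%:R * h)%:E < sigma w)%E by apply: le_lt_trans sM; rewrite lee_fin.
by rewrite ihB// indicF// mulr0 addr0.
Qed.

Let step_measurable h M : 0 < h -> measurable_fun [set: S] (laplace_step h M).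
Proof.
move=> h0; apply: measurable_sum => k; apply: measurable_funM => //.
by apply: measurable_indic; apply: msigma; rewrite mulr_ge0// ltW.
Qed.

(** With (n+1)^2 steps of this mesh the grid reaches time n+1, and exp(-(n+1)) <= 1/(n+1): the
    truncation error and the step error are both at most the mesh. *)
Definition laplace_mesh (n : nat) : R := n.+1%:R^-1.

Let mesh_gt0 n : 0 < laplace_mesh n. Proof. by rewrite /laplace_mesh. Qed.

Let step_bounds n w :
  laplace_step (laplace_mesh n) (n.+1 * n.+1) w <= phi w <=
  laplace_step (laplace_mesh n) (n.+1 * n.+1) w + 2 * laplace_mesh n.
Proof.
have /andP[-> /le_trans->//] := laplace_step_bounds (n.+1 * n.+1) w (mesh_gt0 n).
rewrite lerD2l [leRHS](_ : _ = laplace_mesh n + laplace_mesh n); last by ring.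
rewrite lerD2r /laplace_mesh natrM mulfK// expRN.
rewrite lef_pV2 ?posrE ?expR_gt0//.
by apply: le_trans (expR_ge1Dx _); rewrite lerDr.
Qed.

Lemma laplace_measurable : measurable_fun [set: S] (fun w => expeR (- sigma w)).
Proof.
under eq_fun do rewrite phiE; apply/measurable_EFinP.
apply: (@measurable_fun_cvg _ _ _ _
  (fun n => laplace_step (laplace_mesh n) (n.+1 * n.+1))).
  by move=> n; exact: step_measurable.
move=> w _; apply: (@squeeze_invS _
  (fun n => laplace_step (laplace_mesh n) (n.+1 * n.+1) w)).
by move=> n; exact: step_bounds.
Qed.

Hypothesis mu1 : mu [set: S] = 1%E.

Let mu_fin (A : set S) : measurable A -> mu A \is a fin_num.
Proof.
move=> mA; rewrite ge0_fin_numE//; apply: (@le_lt_trans _ _ (mu [set: S])).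
  by apply: le_measure; rewrite ?inE.
by rewrite mu1 ltry.
Qed.

Let integral_le (f g : S -> R) : measurable_fun [set: S] f ->
  measurable_fun [set: S] g -> (forall w, 0 <= f w) -> (forall w, f w <= g w) ->
  (\int[mu]_w (f w)%:E <= \int[mu]_w (g w)%:E)%E.
Proof.
move=> mf mg f0 fg; apply: ge0_le_integral => //.
- by move=> w _; rewrite lee_fin.
- exact/measurable_EFinP.
- exact/measurable_EFinP.
- by move=> w _; rewrite lee_fin.
Qed.

Let phi_measurable : measurable_fun [set: S] phi.
Proof.
by have := laplace_measurable; under eq_fun do rewrite phiE; move/measurable_EFinP.
Qed.

Let phi_ge0 w : 0 <= phi w. Proof. by rewrite fine_ge0// expeR_ge0. Qed.

Let phi_le1 w : phi w <= 1.
Proof. by have := phi_le (sigma0 w); rewrite oppr0 expR0. Qed.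

Let integral_cst1 (c : R) : (\int[mu]_w c%:E = c%:E)%E.
Proof. by rewrite integral_cst// mu1 mule1. Qed.

Let laplace : R := fine (\int[mu]_w expeR (- sigma w))%E.

Let laplaceE : (\int[mu]_w (phi w)%:E = laplace%:E)%E.
Proof.
rewrite /laplace; under [in RHS]eq_integral do rewrite phiE.
rewrite fineK// ge0_fin_numE; last by apply: integral_ge0 => w _; rewrite lee_fin.
apply: (@le_lt_trans _ _ 1%E); last by rewrite ltry.
by rewrite -(integral_cst1 1); apply: integral_le.
Qed.

Definition laplace_sum (n : nat) (D : R -> R) : R :=
  \sum_(k < n.+1 * n.+1)
    (expR (- (k%:R * laplace_mesh n)) - expR (- (k.+1%:R * laplace_mesh n))) *
    D (k%:R * laplace_mesh n).

(** The Laplace transform is approximated using only the distribution function of sigma. With [mu]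
    the completed law at x this makes e_K a limit of combinations of hitting probabilities, so its
    measurability in x can be proved although the sigma-algebra of [mu] varies with x. *)
Lemma laplace_sum_bounds n :
  laplace_sum n (fun t => fine (mu [set w | (sigma w <= t%:E)%E])) <= laplace <=
  laplace_sum n (fun t => fine (mu [set w | (sigma w <= t%:E)%E])) +
    2 * laplace_mesh n.
Proof.
set G := laplace_sum _ _; set h := laplace_mesh n.
have h0 : 0 < h by exact: mesh_gt0.
have mk (k : nat) : measurable [set w | (sigma w <= (k%:R * h)%:E)%E].
  by apply: msigma; rewrite mulr_ge0// ltW.
have c0 (k : nat) : 0 <= expR (- (k%:R * h)) - expR (- (k.+1%:R * h)).
  by rewrite subr_ge0 ler_expR lerN2 ler_pM2r// ler_nat.
have step0 w : 0 <= laplace_step h (n.+1 * n.+1) w.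
  by apply: sumr_ge0 => k _; rewrite mulr_ge0.
have GE : (\int[mu]_w (laplace_step h (n.+1 * n.+1) w)%:E = G%:E)%E.
  under eq_integral do rewrite -sumEFin.
  rewrite ge0_integral_sum//; last 2 first.
  - move=> k; apply/measurable_EFinP; apply: measurable_funM => //.
  - by move=> k w _; rewrite lee_fin mulr_ge0.
  rewrite /G /laplace_sum -sumEFin; apply: eq_bigr => k _.
  under eq_integral do rewrite EFinM.
  rewrite ge0_integralZl//; last by rewrite lee_fin; exact: c0.
  by rewrite integral_indic ?setIT ?EFinM ?fineK ?mu_fin//; exact: mk.
  exact/measurable_EFinP/measurable_indic/mk.
have mst := step_measurable (n.+1 * n.+1) h0.
have b w := step_bounds n w.
apply/andP; split; rewrite -lee_fin.
  by rewrite -GE -laplaceE; apply: integral_le => // w; have /andP[] := b w.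
rewrite EFinD -GE -laplaceE -(integral_cst1 (2 * h)).
rewrite -ge0_integralD//; last 2 first.
- exact/measurable_EFinP.
- by move=> w _; rewrite lee_fin mulr_ge0// ltW.
under [leRHS]eq_integral do rewrite -EFinD.
apply: integral_le => //; first exact: measurable_funD.
  by move=> w; have /andP[] := b w.
by move=> w _; rewrite lee_fin; exact: step0.
Qed.

Lemma laplace_le (t : R) : 0 <= t ->
  0 <= laplace <= fine (mu [set w | (sigma w <= t%:E)%E]) + expR (- t).
Proof.
move=> t0; apply/andP; split.
  by rewrite fine_ge0// integral_ge0// => w _; exact: expeR_ge0.
have mt := msigma t0.
rewrite -lee_fin -laplaceE EFinD fineK ?mu_fin// -(integral_cst1 (expR (- t))).
set A := [set w | _] in mt *.
have mA : measurable_fun [set: S] (fun w => (\1_A w : R)%:E).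
  exact/measurable_EFinP/measurable_indic.
have A0 w : [set: S] w -> (0 <= (\1_A w : R)%:E)%E by rewrite lee_fin.
have e0 (w : S) : [set: S] w -> (0 <= (expR (- t))%:E)%E by rewrite lee_fin expR_ge0.
rewrite -[X in (mu X + _)%E]setIT -integral_indic// -ge0_integralD//.
under [leRHS]eq_integral do rewrite -EFinD.
apply: integral_le => //.
  by apply: measurable_funD => //; exact: measurable_indic.
move=> w; rewrite indicE; case: (boolP (w \in _)).
  by move=> _; apply: (le_trans (phi_le1 w)); rewrite lerDl expR_ge0.
rewrite notin_setE /= => /negP; rewrite -ltNge add0r => /ltW; exact: phi_le.
Qed.

Lemma laplace_ge (t : R) (A : set S) : measurable A ->
  (forall w, A w -> (sigma w <= t%:E)%E) -> expR (- t) * fine (mu A) <= laplace.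
Proof.
move=> mA At; rewrite -lee_fin -laplaceE EFinM fineK ?mu_fin//.
have mA' : measurable_fun [set: S] (fun w => (\1_A w : R)%:E).
  exact/measurable_EFinP/measurable_indic.
have A0 w : [set: S] w -> (0 <= (\1_A w : R)%:E)%E by rewrite lee_fin.
have e0 : (0 <= (expR (- t))%:E)%E by rewrite lee_fin expR_ge0.
rewrite -[X in (_ * mu X)%E]setIT -integral_indic// -ge0_integralZl//.
under eq_integral do rewrite -EFinM.
apply: integral_le => //.
- by apply: measurable_funM => //; exact: measurable_indic.
- move=> w; rewrite indicE; case: (boolP (w \in _)); last by rewrite mulr0.
  by rewrite inE mulr1 => /At; exact: phi_ge.
Qed.

End LaplaceTransform.

(** * Visits of the process *)

Section Markov.
Context {R : realType} {X : ptopologicalType}.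
Context {d : measure_display} {Omega : measurableType d}.
Variable Z : hunt_process R X Omega.
Local Open Scope ereal_scope.

Local Notation P := (hunt_law Z).
Local Notation pth := (hunt_path Z).
Local Notation M := (hunt_filtration Z).

Lemma filtration_mono s t : (0 <= s)%R -> (s <= t)%R -> M s `<=` M t.
Proof.
move=> s0; rewrite le_eqVlt => /orP[/eqP <-//|st].
by rewrite (hunt_filtration_right_continuous Z s0) => A; apply.
Qed.

Lemma path_measurable_preimage t (B : set (opc X)) : (0 <= t)%R ->
  borel_set (opc X) B -> measurable (pth t @^-1` B).
Proof.
by move=> t0 mB; exact: (hunt_filtration_sub t0) (hunt_adapted Z t0 mB).
Qed.

Lemma path_measurable t : (0 <= t)%R ->
  measurable_fun [set: Omega] (pth t : Omega -> borel (opc X)).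
Proof. by move=> t0 _ B mB; rewrite setTI; exact: path_measurable_preimage. Qed.

Definition transition (r : R) (f : opc X -> \bar R) (y : opc X) : \bar R :=
  \int[P y]_w f (pth r w).

Lemma transition_ge0 r f y : (forall z, 0 <= f z) -> 0 <= transition r f y.
Proof. by move=> f0; exact: integral_ge0. Qed.

Lemma transition_indic r (B : set (opc X)) y : (0 <= r)%R -> borel_set (opc X) B ->
  transition r (fun z => (\1_B z)%:E) y = P y (pth r @^-1` B).
Proof.
move=> r0 mB; rewrite /transition.
rewrite -[in RHS](setIT (pth r @^-1` B)) -integral_indic//.
exact: path_measurable_preimage.
Qed.

Lemma transition_measurable r f : (0 <= r)%R -> (forall z, 0 <= f z) ->
  measurable_fun [set: borel (opc X)] f ->
  measurable_fun [set: borel (opc X)] (transition r f).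
Proof.
move=> r0 f0 mf; have mp := path_measurable r0.
move: f f0 mf; apply: ge0_measurable_ind.
- move=> A mA; rewrite [X in measurable_fun _ X](_ : _ = fun y => P y (pth r @^-1` A)).
    exact: hunt_law_measurable.
  by apply/funext => y; exact: transition_indic.
- move=> c f c0 f0 mf ih.
  rewrite [X in measurable_fun _ X](_ : _ = fun y => c%:E * transition r f y).
    by apply: emeasurable_funM.
  apply/funext => y; rewrite /transition ge0_integralZl//.
  exact: (measurableT_comp mf).
- move=> f g f0 g0 mf mg ihf ihg.
  rewrite [X in measurable_fun _ X](_ : _ = fun y => transition r f y + transition r g y).
    exact: emeasurable_funD.
  apply/funext => y; rewrite /transition ge0_integralD//;
  (exact: (measurableT_comp mf) || exact: (measurableT_comp mg)).
- move=> f_ f0 mf fmono ih.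
  rewrite [X in measurable_fun _ X](_ : _ = fun y => limn (fun n => transition r (f_ n) y)).
    apply: (@emeasurable_fun_cvg _ (borel (opc X)) R setT
      (fun n (y : borel (opc X)) => transition r (f_ n) y)) => // y _.
    apply: ereal_nondecreasing_is_cvgn => n k nk; apply: ge0_le_integral => //.
    - exact: (measurableT_comp (mf n)).
    - exact: (measurableT_comp (mf k)).
    - by move=> w _; exact: fmono.
  apply/funext => y; rewrite /transition monotone_convergence//.
  by move=> n; exact: (measurableT_comp (mf n)).
Qed.

(** For indicators this is the strong Markov property at the constant stopping time s; the induction
    over nonnegative functions does the rest. *)
Lemma markov_property y s r (A : set Omega) f : (0 <= s)%R -> (0 <= r)%R ->
  M s A -> (forall z, 0 <= f z) -> measurable_fun [set: borel (opc X)] f ->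
  \int[P y]_(w in A) f (pth (s + r)%R w) =
  \int[P y]_(w in A) transition r f (pth s w).
Proof.
move=> s0 r0 MA f0 mf.
have mA : measurable A by exact: hunt_filtration_sub MA.
have sr0 : (0 <= s + r)%R by rewrite addr_ge0.
have [ms msr] := (path_measurable s0, path_measurable sr0).
have mc t g : (0 <= t)%R -> measurable_fun [set: borel (opc X)] g ->
    measurable_fun A (fun w => g (pth t w) : \bar R).
  move=> t0 mg; apply: (@measurable_funS _ _ _ _ setT) => //.
  exact: (measurableT_comp mg (path_measurable t0)).
move: f f0 mf; apply: ge0_measurable_ind.
- move=> B mB; under [RHS]eq_integral do rewrite transition_indic//.
  have st : stopping_time M (fun=> s%:E).
    split=> [w|t t0]; first by rewrite lee_fin.
    have [H0 HD _] := hunt_filtration_sigma Z t0.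
    case: (leP s t) => st.
      rewrite (_ : [set _ | _] = setT `\` set0); first exact: HD.
      by rewrite setD0; apply/seteqP; split=> w //= _; rewrite lee_fin.
    rewrite (_ : [set _ | _] = set0)//.
    by rewrite -subset0 => w /=; rewrite lee_fin leNgt st.
  have sA : stopped_events M (fun=> s%:E) A.
    split=> // t t0; case: (leP s t) => st'.
      rewrite (_ : _ `&` _ = A); first exact: (filtration_mono s0 st').
      by apply/seteqP; split=> [w []//|w Aw]; split=> //=; rewrite lee_fin.
    rewrite (_ : _ `&` _ = set0); first by have [] := hunt_filtration_sigma Z t0.
    by rewrite -subset0 => w /= [_]; rewrite lee_fin leNgt st'.
  have := hunt_strong_markov y st sA r0 mB.
  rewrite (_ : A `&` [set w | _ < _] = A); last first.
    by apply/seteqP; split=> [w []//|w Aw]; split=> //=; rewrite ltry.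
  move=> <-; rewrite integral_indic//; last exact: path_measurable_preimage.
  congr (P y _); rewrite setIC; apply/seteqP; split=> w /= [Aw].
    by split=> //; rewrite ltry.
  by case.
- move=> c f c0 f0 mf ih; rewrite ge0_integralZl//; last exact: mc.
  rewrite ih -ge0_integralZl//.
  + apply: eq_integral => w _; rewrite /transition ge0_integralZl//.
    exact: (measurableT_comp mf (path_measurable r0)).
  + apply: mc => //; exact: transition_measurable.
  + by move=> w _; exact: transition_ge0.
- move=> f g f0 g0 mf mg ihf ihg.
  rewrite ge0_integralD//; [|exact: mc..].
  rewrite ihf ihg -ge0_integralD//.
  + apply: eq_integral => w _; rewrite /transition ge0_integralD//;
      (exact: (measurableT_comp mf (path_measurable r0)) ||
       exact: (measurableT_comp mg (path_measurable r0))).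
  + by move=> w _; exact: transition_ge0.
  + apply: mc => //; exact: transition_measurable.
  + by move=> w _; exact: transition_ge0.
  + apply: mc => //; exact: transition_measurable.
- move=> f_ f0 mf fmono ih.
  rewrite monotone_convergence//; last by move=> n; exact: mc.
  under eq_fun do rewrite ih.
  rewrite -monotone_convergence//.
  + apply: eq_integral => w _; rewrite /transition monotone_convergence//.
    by move=> n; exact: (measurableT_comp (mf n) (path_measurable r0)).
  + by move=> n; apply: mc => //; exact: transition_measurable.
  + by move=> n w _; exact: transition_ge0.
  + move=> w _ n k nk; apply: ge0_le_integral => //.
    * exact: (measurableT_comp (mf n) (path_measurable r0)).
    * exact: (measurableT_comp (mf k) (path_measurable r0)).
    * by move=> w' _; exact: fmono.
Qed.

Lemma borel_None : borel_set (opc X) [set None].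
Proof.
rewrite -[[set None]]setCK; apply: measurableC; apply: sub_sigma_algebra.
rewrite (_ : ~` [set None] = Some @` [set: X]).
  exact: one_point_compactification_open_some openT.
by apply/seteqP; split=> [[x|]//= _|_ [x _ <-]//]; exists x.
Qed.

Section Grid.
Variables (U : set (opc X)) (dl : R).
Hypothesis mU : borel_set (opc X) U.
Hypothesis dl0 : (0 <= dl)%R.

(* [grid_hit n y] is the probability under P^y that the path is in U at one of
   the times 0, dl, ..., n dl. *)
Fixpoint grid_hit (n : nat) (y : opc X) : \bar R :=
  if n is n'.+1 then (\1_U y)%:E + (\1_(~` U) y)%:E * transition dl (grid_hit n') y
  else (\1_U y)%:E.

Definition grid_event (s : R) (n : nat) : set Omega :=
  [set w | exists2 k, (k <= n)%N & U (pth (s + k%:R * dl)%R w)].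

Lemma grid_hit_ge0 n y : 0 <= grid_hit n y.
Proof.
elim: n y => [|n ih] y /=; first by rewrite lee_fin.
by rewrite adde_ge0 ?mule_ge0 ?lee_fin// transition_ge0.
Qed.

Let m1 (A : set (opc X)) : borel_set (opc X) A ->
  measurable_fun [set: borel (opc X)] (fun y => (\1_A y)%:E : \bar R).
Proof. by move=> mA; apply/measurable_EFinP; exact: measurable_indic. Qed.

Lemma grid_hit_measurable n : measurable_fun [set: borel (opc X)] (grid_hit n).
Proof.
elim: n => [|n ih] /=; first exact: m1.
apply: emeasurable_funD; first exact: m1.
apply: emeasurable_funM; first by apply: m1; exact: measurableC.
by apply: transition_measurable => // z; exact: grid_hit_ge0.
Qed.

Lemma grid_hit_le1 n y : grid_hit n y <= 1.
Proof.
elim: n y => [|n ih] y /=; first by rewrite lee_fin indicE; case: (y \in U).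
rewrite !indicE in_setC; case: (y \in U); first by rewrite mul0e adde0.
rewrite add0e mul1e -(@probability_setT _ _ _ (P y)) -[leRHS]mul1e -integral_cst//.
apply: ge0_le_integral => //.
- by move=> w _; exact: grid_hit_ge0.
- exact: (measurableT_comp (grid_hit_measurable n) (path_measurable dl0)).
Qed.

Lemma grid_event_measurable s n : (0 <= s)%R -> measurable (grid_event s n).
Proof.
move=> s0; rewrite (_ : grid_event s n =
  \bigcup_(k in `I_n.+1) (pth (s + k%:R * dl)%R @^-1` U)).
  apply: bigcup_measurable => k _; apply: path_measurable_preimage => //.
  by rewrite addr_ge0// mulr_ge0.
by apply/seteqP; split=> w /= [k kn Uk]; exists k => //=; move: kn; rewrite ltnS.
Qed.

(** Induction on n with s and A free. Paths in U at time s are counted at once. For the others, the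
    event A with X_s outside U belongs to [M s], hence to [M (s + dl)], where the induction
    hypothesis applies; the Markov property then brings the integrand back to time s. *)
Lemma grid_event_prob y s n (A : set Omega) : (0 <= s)%R -> M s A ->
  P y (A `&` grid_event s n) = \int[P y]_(w in A) grid_hit n (pth s w).
Proof.
elim: n s A => [|n ih] s A s0 MA.
  have mA : measurable A by exact: hunt_filtration_sub MA.
  rewrite /= integral_indic//; last exact: path_measurable_preimage.
  congr (P y _); rewrite setIC; congr (_ `&` _); apply/seteqP; split=> w /=.
    by move=> [k]; rewrite leqn0 => /eqP -> /=; rewrite mul0r addr0.
  by move=> Uw; exists 0%N => //; rewrite mul0r addr0.
have sdl0 : (0 <= s + dl)%R by rewrite addr_ge0.
have mA : measurable A by exact: hunt_filtration_sub MA.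
have mUs : measurable (pth s @^-1` U) by exact: path_measurable_preimage.
have MU : M s (pth s @^-1` (~` U)) by apply: hunt_adapted => //; exact: measurableC.
have MI (B C : set Omega) : M s B -> M s C -> M s (B `&` C).
  have [M0 MD MB] := hunt_filtration_sigma Z s0.
  have MC B' : M s B' -> M s (~` B') by move=> /MD; rewrite setTD.
  move=> mB mC; rewrite -[B `&` C]setCK setCI -bigcup2E; apply: (MC); apply: (MB).
  by move=> [|[|k]] /=; [exact: MC|exact: MC|exact: M0].
have MAU : M s (A `&` pth s @^-1` (~` U)) by exact: MI.
have MAU' : M (s + dl)%R (A `&` pth s @^-1` (~` U)).
  by apply: (filtration_mono s0) MAU; rewrite lerDl.
have sE k : (s + dl + k%:R * dl = s + k.+1%:R * dl)%R by rewrite -natr1; ring.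
have -> : A `&` grid_event s n.+1 = (A `&` pth s @^-1` U) `|`
    ((A `&` pth s @^-1` (~` U)) `&` grid_event (s + dl)%R n).
  apply/seteqP; split=> w.
    move=> [Aw [[|k] kn Uk]].
      by left; split=> //; rewrite mul0r addr0 in Uk.
    have [Us|nUs] := pselect (U (pth s w)); first by left.
    right; split=> //; exists k => //.
    by rewrite sE.
  move=> [[Aw Us]|[[Aw nUs] [k kn Uk]]]; split=> //.
    by exists 0%N => //; rewrite mul0r addr0.
  by exists k.+1 => //; rewrite -sE.
rewrite measureU//; last 3 first.
- exact: measurableI.
- apply: measurableI; last exact: grid_event_measurable.
  exact: hunt_filtration_sub MAU.
- by rewrite -subset0 => w [[_ Us] [[_ /(_ Us)]]].
transitivity (P y (A `&` pth s @^-1` U) +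
    \int[P y]_(w in A `&` pth s @^-1` (~` U)) grid_hit n (pth (s + dl)%R w)).
  by congr (_ + _); exact: ih.
rewrite markov_property//; last 2 first.
- by move=> z; exact: grid_hit_ge0.
- exact: grid_hit_measurable.
rewrite [RHS]ge0_integralD//.
- congr (_ + _); first by rewrite setIC -integral_indic//.
  rewrite integral_mkcondr; apply: eq_integral => w _.
  have e : (w \in pth s @^-1` (~` U)) = (pth s w \in ~` U).
    by apply/idP/idP; rewrite !inE.
  by rewrite patchE indicE e; case: (_ \in _); rewrite ?mul1e ?mul0e.
- apply: (@measurable_funS _ _ _ _ setT) => //.
  exact: (measurableT_comp (m1 mU) (path_measurable s0)).
- move=> w _; apply: mule_ge0; first by rewrite lee_fin.
  by apply: transition_ge0 => z; exact: grid_hit_ge0.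
- apply: (@measurable_funS _ _ _ _ setT) => //; apply: emeasurable_funM.
    exact: (measurableT_comp (m1 (measurableC mU)) (path_measurable s0)).
  apply: (measurableT_comp _ (path_measurable s0)).
  apply: transition_measurable => //; first by move=> z; exact: grid_hit_ge0.
  exact: grid_hit_measurable.
Qed.

(** Under the law at the cemetery the path starts there almost surely and is absorbed. This matches
    [grid_hit] with the convention that functions on X are extended by 0. *)
Lemma grid_hit_None n : ~ U None -> grid_hit n None = 0.
Proof.
move=> nU; have i0 : (\1_U (None : opc X))%:E = 0 :> \bar R by rewrite indicE memNset.
elim: n => [//|n ih]; rewrite /= i0 add0e.
suff -> : transition dl (grid_hit n) None = 0 by rewrite mule0.
have mN := borel_None.
rewrite /transition (@ae_eq_integral _ _ _ _ _ (cst 0)) ?integral0//.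
  exact: (measurableT_comp (grid_hit_measurable n) (path_measurable dl0)).
exists (~` (pth 0 @^-1` [set None])); split.
- by apply: measurableC; exact: path_measurable_preimage.
- have mN0 : measurable (pth 0%R @^-1` [set None]) by exact: path_measurable_preimage.
  have := @probability_setC _ _ _ (P None) _ mN0.
  by rewrite hunt_normal subee.
- move=> w /= nw p0; apply: nw => _; rewrite (hunt_absorbing dl0) ?ih//.
  apply: (@le_trans _ _ 0); last by rewrite lee_fin.
  by apply: ereal_inf_lbound; exists 0%R.
Qed.

End Grid.

(** Measurability of y |-> P^y(A) passes to monotone limits but not to arbitrary intersections of
    events; the events below are therefore built from monotone unions and intersections. *)
Definition law_measurable (A : set Omega) :=
  measurable A /\ measurable_fun [set: borel (opc X)] (fun y => P y A).

Lemma law_measurable_bigcup (A : nat -> set Omega) :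
  (forall n, A n `<=` A n.+1) -> (forall n, law_measurable (A n)) ->
  law_measurable (\bigcup_n A n).
Proof.
move=> Amono mA; have mU : measurable (\bigcup_n A n).
  by apply: bigcup_measurable => n _; exact: (mA n).1.
split=> //; apply: (@emeasurable_fun_cvg _ (borel (opc X)) R setT
  (fun n (y : borel (opc X)) => P y (A n))) => [n|y _]; first exact: (mA n).2.
apply: nondecreasing_cvg_mu => //; first by move=> n; exact: (mA n).1.
by apply/nondecreasing_seqP => n; rewrite subsetEset.
Qed.

Lemma law_measurable_bigcap (A : nat -> set Omega) :
  (forall n, A n.+1 `<=` A n) -> (forall n, law_measurable (A n)) ->
  law_measurable (\bigcap_n A n).
Proof.
move=> Amono mA; have mI : measurable (\bigcap_n A n).
  by apply: bigcap_measurable => // n _; exact: (mA n).1.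
split=> //; apply: (@emeasurable_fun_cvg _ (borel (opc X)) R setT
  (fun n (y : borel (opc X)) => P y (A n))) => [n|y _]; first exact: (mA n).2.
apply: nonincreasing_cvg_mu => //.
- by apply: (le_lt_trans (probability_le1 _ _)); [exact: (mA 0%N).1|rewrite ltry].
- by move=> n; exact: (mA n).1.
- by apply/nonincreasing_seqP => n; rewrite subsetEset.
Qed.

Lemma grid_event_transition (U : set (opc X)) dl s n y : borel_set (opc X) U ->
  (0 <= dl)%R -> (0 <= s)%R ->
  P y (grid_event U dl s n) = transition s (grid_hit U dl n) y.
Proof.
move=> mU dl0 s0; rewrite -[X in P y X]setTI grid_event_prob//.
have [M0 MD _] := hunt_filtration_sigma Z s0.
by have := MD _ M0; rewrite setD0.
Qed.

Lemma law_measurable_grid (U : set (opc X)) dl s n : borel_set (opc X) U ->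
  (0 <= dl)%R -> (0 <= s)%R -> law_measurable (grid_event U dl s n).
Proof.
move=> mU dl0 s0; split; first exact: grid_event_measurable.
under eq_fun do rewrite grid_event_transition//.
apply: transition_measurable => //; first by move=> z; exact: grid_hit_ge0.
exact: grid_hit_measurable.
Qed.

Definition visit (U : set (opc X)) (s t : R) : set Omega :=
  [set w | exists q, [/\ (s <= q)%R, (q < t)%R & U (pth q w)]].

(** If the path is in the open set U at time q < t, right-continuity keeps it there for a short
    while, which contains a point of every fine grid. Dyadic meshes make the grid events increase,
    and [n_ l] is the last index with grid time below t. That bound places visits in [M t] and
    yields the factor exp(t) in their domination. *)
Lemma visit_gridE (U : set (opc X)) s t : @open (opc X) U -> (0 <= s)%R -> (s < t)%R ->
  exists n_ : nat -> nat,
  [/\ visit U s t = \bigcup_l grid_event U (2^-1 ^+ l)%R s (n_ l),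
     forall l, grid_event U (2^-1 ^+ l)%R s (n_ l) `<=`
               grid_event U (2^-1 ^+ l.+1)%R s (n_ l.+1) &
     forall l, (s + (n_ l)%:R * 2^-1 ^+ l < t)%R].
Proof.
move=> oU s0 st.
have h0 l : (0 < (2^-1 : R) ^+ l)%R by rewrite exprn_gt0.
have /choice[n_ nE] : forall l, exists n : nat,
    forall k, (s + k%:R * 2^-1 ^+ l < t)%R = (k <= n)%N.
  move=> l; pose p (k : nat) := (s + k%:R * 2^-1 ^+ l < t)%R.
  have pb k : p k -> (k <= Num.truncn ((t - s) / 2^-1 ^+ l))%N.
    rewrite /p addrC -ltrBrDr -ltr_pdivlMr// => /ltW kt.
    by rewrite truncn_ge_nat// (le_trans _ kt).
  have p0 : exists k, p k by exists 0%N; rewrite /p mul0r addr0.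
  exists (ex_maxn p0 pb); case: ex_maxnP => n pn nmax k; apply/idP/idP => [/nmax//|kn].
  by apply: le_lt_trans pn; rewrite lerD2l ler_pM2r// ler_nat.
exists n_; split.
- apply/seteqP; split=> [w [q [sq qt Uq]]|w [l _ [k kn Uk]]]; last first.
    exists (s + k%:R * 2^-1 ^+ l)%R.
    by split=> //; [rewrite lerDl mulr_ge0// ltW|rewrite nE].
  have q0 : (0 <= q)%R by exact: le_trans sq.
  have [e /= e0 He] : nbhs (q^'+) ((fun r => pth r w) @^-1` U).
    have UN : nbhs (pth q w) U by exact: open_nbhs_nbhs.
    by have /(_ U UN) := @hunt_right_continuous _ _ _ _ Z w q q0.
  have /ltr_add_invr[l] : (0 < Num.min e (t - q))%R by rewrite lt_min e0 subr_gt0.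
  rewrite add0r => le.
  have {le} : (2^-1 ^+ l < Num.min e (t - q))%R.
    apply: le_lt_trans le; rewrite exprVn lef_pV2 ?posrE ?exprn_gt0//.
    by rewrite -natrX ler_nat ltn_expl.
  rewrite lt_min => /andP[le lt].
  (* The first grid index strictly after q: the grid time lies in ]q, q + 2^-l]. *)
  pose k := (Num.truncn ((q - s) / 2^-1 ^+ l)).+1.
  have qs0 : (0 <= (q - s) / 2^-1 ^+ l)%R by rewrite divr_ge0 ?subr_ge0// ltW.
  have /andP[k1 k2] := truncn_itv qs0.
  have qk : (q < s + k%:R * 2^-1 ^+ l)%R.
    by rewrite addrC -ltrBlDr -ltr_pdivrMr//.
  have kq : (s + k%:R * 2^-1 ^+ l <= q + 2^-1 ^+ l)%R.
    rewrite /k -natr1 mulrDl mul1r addrA lerD2r addrC -lerBrDr.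
    by rewrite -ler_pdivlMr//.
  exists l => //; exists k.
    by rewrite -nE (le_lt_trans kq)// -ltrBrDl.
  apply: He => //=; rewrite ltr0_norm ?subr_lt0// opprB ltrBlDl.
  by rewrite (le_lt_trans kq)// ltrD2l.
- move=> l w [k kn Uk]; exists (k.*2)%N; last first.
    by move: Uk; rewrite exprS mulrA -muln2 natrM mulfK.
  by rewrite -nE exprS mulrA -muln2 natrM mulfK// nE.
- by move=> l; rewrite nE.
Qed.

Lemma visit_empty U s t : (t <= s)%R -> visit U s t = set0.
Proof.
move=> ts; rewrite -subset0 => w [q [sq qt _]].
by move: (le_lt_trans sq qt); rewrite ltNge ts.
Qed.

Lemma borel_open (U : set (opc X)) : @open (opc X) U -> borel_set (opc X) U.
Proof. by move=> oU; exact: sub_sigma_algebra. Qed.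

Lemma law_measurable_visit (U : set (opc X)) s t : @open (opc X) U ->
  (0 <= s)%R -> law_measurable (visit U s t).
Proof.
move=> oU s0; have [ts|st] := leP t s.
  rewrite visit_empty//; split=> //.
  by under eq_fun do rewrite measure0; exact: measurable_cst.
have [n_ [-> nmono _]] := visit_gridE oU s0 st.
apply: law_measurable_bigcup => // l; apply: law_measurable_grid => //.
  exact: borel_open.
Qed.

Lemma visit_filtration (U : set (opc X)) s t : @open (opc X) U ->
  (0 <= s)%R -> (0 <= t)%R -> M t (visit U s t).
Proof.
move=> oU s0 t0; have [M0 MD MB] := hunt_filtration_sigma Z t0.
have [ts|st] := leP t s; first by rewrite visit_empty.
have [n_ [-> _ nt]] := visit_gridE oU s0 st.
apply: (MB) => l.
rewrite (_ : grid_event U _ s _ = \bigcup_k (if (k <= n_ l)%N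
    then pth (s + k%:R * 2^-1 ^+ l)%R @^-1` U else set0)).
  apply: (MB) => k; case: ifPn => // kn.
  have sk0 : (0 <= s + k%:R * 2^-1 ^+ l)%R by rewrite addr_ge0// mulr_ge0.
  have skt : (s + k%:R * 2^-1 ^+ l <= t)%R.
    by apply: le_trans (ltW (nt l)); rewrite lerD2l ler_wpM2r// ler_nat.
  exact: (filtration_mono sk0 skt) (hunt_adapted Z sk0 (borel_open oU)).
apply/seteqP; split=> w [k]; first by move=> kn Uk; exists k => //; rewrite kn.
by move=> _; case: ifPn => // kn Uk; exists k.
Qed.

(** * Hitting times of compact sets *)

Section HittingCompact.
Variables (K : set X) (U : nat -> set X).
Hypothesis oU : forall n, open (U n).
Hypothesis KU : forall n, K `<=` U n.
Hypothesis Umono : forall n, U n.+1 `<=` U n.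
Hypothesis Usep : forall y : opc X, ~ (Some @` K) y ->
  exists2 W, nbhs y W & exists n, W `&` Some @` U n = set0.

Let V n : set (opc X) := Some @` U n.

Let oV n : @open (opc X) (V n).
Proof. exact: one_point_compactification_open_some. Qed.

Let Vmono i j : (i <= j)%N -> V j `<=` V i.
Proof.
move=> /subnK <-; elim: (j - i)%N => [|k ih] //.
by rewrite addSn; apply: subset_trans ih; exact: image_subset.
Qed.

(** Times below s are discarded because sigma_K ignores time 0: with s > 0 the limit of the entrance
    times is positive, so it is admissible in the infimum defining sigma_K. Afterwards s runs
    through 1/(i+1). *)
Definition entrance_time (s : R) (n : nat) (w : Omega) : \bar R :=
  ereal_inf [set q%:E | q in [set q | (s <= q)%R /\ V n (pth q w)]].

Lemma entrance_time_lt s n r w :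
  (entrance_time s n w < r%:E) <-> visit (V n) s r w.
Proof.
split=> [/ereal_inf_lt[_ [q [sq Vq] <-]]|[q [sq qr Vq]]].
  by rewrite lte_fin => qr; exists q.
apply: (@le_lt_trans _ _ q%:E); last by rewrite lte_fin.
by apply: ereal_inf_lbound; exists q.
Qed.

Lemma entrance_time_ge s n w : s%:E <= entrance_time s n w.
Proof. by apply: le_ereal_inf_tmp => _ [q [sq _] <-]; rewrite lee_fin. Qed.

Lemma entrance_time_stopping s n : (0 <= s)%R -> stopping_time M (entrance_time s n).
Proof.
move=> s0; split=> [w|t t0].
  by apply: le_trans (entrance_time_ge s n w); rewrite lee_fin.
rewrite (hunt_filtration_right_continuous Z t0) => r /= tr.
(* Starting the sequence at [k0] keeps all times t + 1/(k0+k+1) at most r, so the intersection lies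
   in [M r]; r > t is arbitrary and the filtration is right-continuous. *)
have /ltr_add_invr[k0 k0r] := tr.
have r0 : (0 <= r)%R by exact: le_trans (ltW tr).
have [_ MD MB] := hunt_filtration_sigma Z r0.
have MC A : M r A -> M r (~` A) by move=> /MD; rewrite setTD.
rewrite (_ : [set w | _] = \bigcap_k visit (V n) s (t + (k0 + k).+1%:R^-1)%R).
  rewrite -[X in M r X]setCK setC_bigcap; apply: (MC); apply: (MB) => k; apply: (MC).
  have tk0 : (0 <= t + (k0 + k).+1%:R^-1)%R by rewrite addr_ge0.
  have tkr : (t + (k0 + k).+1%:R^-1 <= r)%R.
    apply: le_trans (ltW k0r); rewrite lerD2l lef_pV2 ?posrE// ler_nat.
    by rewrite ltnS leq_addr.
  exact: (filtration_mono tk0 tkr) (visit_filtration (@oV n) s0 tk0).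
apply/seteqP; split=> w /=.
  move=> h k _; apply/entrance_time_lt; apply: (le_lt_trans h).
  by rewrite lte_fin ltrDl.
move=> h; apply/lee_addgt0Pr => e e0.
have /ltr_add_invr[k] := e0; rewrite add0r => ke.
have /entrance_time_lt/ltW/le_trans := h k I; apply.
rewrite -EFinD lee_fin lerD2l; apply: le_trans (ltW ke).
by rewrite lef_pV2 ?posrE// ler_nat ltnS leq_addl.
Qed.

Lemma entrance_time_nd s w : {homo (entrance_time s)^~ w : n k / (n <= k)%N >-> n <= k}.
Proof.
move=> n k nk; apply: ereal_inf_le_tmp => _ [q [sq Vq] <-].
by exists q => //; split=> //; exact: (Vmono nk).
Qed.

Definition entrance_limit (s : R) (w : Omega) : \bar R :=
  ereal_sup (range ((entrance_time s)^~ w)).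

Lemma entrance_time_cvg s w : entrance_time s n w @[n --> \oo] --> entrance_limit s w.
Proof. by apply: ereal_nondecreasing_cvgn => n k; exact: entrance_time_nd. Qed.

(** Were the limit point y off K, some neighbourhood W of y would miss [V n0]. For large n the path
    is in the interior of W at its entrance time, hence in W shortly afterwards; but the entrance
    time, being an infimum, is attained or approached from the right by times in [V n], which is
    contained in [V n0]. *)
Lemma entrance_limit_hits s w : (0 <= s)%R -> entrance_limit s w < +oo ->
  pth (fine (entrance_time s n w)) w @[n --> \oo] -->
    pth (fine (entrance_limit s w)) w ->
  (Some @` K) (pth (fine (entrance_limit s w)) w).
Proof.
move=> s0 fin cvgp; apply: contrapT => /Usep[W yW [n0 Wn0]].
have yW' : nbhs (pth (fine (entrance_limit s w)) w) W° by exact: nbhs_interior.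
have [N _ HN] := cvgp _ yW'.
pose n := maxn N n0.
have Wn : W° (pth (fine (entrance_time s n w)) w) by apply: HN; exact: leq_maxl.
have le_lim : entrance_time s n w <= entrance_limit s w.
  by apply: ereal_sup_ubound; exists n.
have nfin : entrance_time s n w \is a fin_num.
  rewrite fin_numElt (le_lt_trans le_lim fin) andbT.
  by apply: lt_le_trans (entrance_time_ge s n w); rewrite ltNyr.
set r := fine (entrance_time s n w) in Wn *.
have rE : entrance_time s n w = r%:E by rewrite fineK.
have r0 : (0 <= r)%R.
  by rewrite -lee_fin -rE; apply: le_trans (entrance_time_ge s n w); rewrite lee_fin.
have [e /= e0 He] : nbhs (r^'+) ((fun q => pth q w) @^-1` W).
  by have /(_ W Wn) := @hunt_right_continuous _ _ _ _ Z w r r0.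
have /entrance_time_lt[q [sq qre Vq]] : entrance_time s n w < (r + e)%:E.
  by rewrite rE lte_fin ltrDl.
have rq : (r <= q)%R.
  by rewrite -lee_fin -rE; apply: ereal_inf_lbound; exists q.
have Wq : W (pth q w).
  move: rq; rewrite le_eqVlt => /orP[/eqP <-|rq]; first exact: interior_subset Wn.
  by apply: He => //=; rewrite distrC gtr0_norm ?subr_gt0// ltrBlDl.
have : (W `&` Some @` U n0) (pth q w).
  by split=> //; apply: (Vmono (leq_maxr N n0)).
by rewrite Wn0.
Qed.

(* Equal to {sigma_K <= t} up to P^y-null sets, for all y; unlike the latter, its
   measurability and that of its probability as a function of y are immediate. *)
Definition hitting_event (t : R) : set Omega :=
  \bigcap_k \bigcup_i \bigcap_j visit (V j) i.+1%:R^-1%R (t + k.+1%:R^-1)%R.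

(** The visits decrease in j, increase in i and, once i is quantified, decrease in k, so each of the
    three operations is a monotone limit. *)
Lemma hitting_event_law t : law_measurable (hitting_event t).
Proof.
apply: law_measurable_bigcap => [k w [i _ h]|k].
  exists i => // j _; have [q [iq qt Vq]] := h j I; exists q; split=> //.
  by apply: (lt_le_trans qt); rewrite lerD2l lef_pV2 ?posrE// ler_nat.
apply: law_measurable_bigcup => [i w h j _|i].
  have [q [iq qt Vq]] := h j I; exists q; split=> //.
  by apply: le_trans iq; rewrite lef_pV2 ?posrE// ler_nat.
apply: law_measurable_bigcap => [j w [q [iq qt Vq]]|j].
  by exists q; split=> //; exact: Vmono Vq.
exact: law_measurable_visit.
Qed.

Lemma hitting_time_le_event t :
  [set w | hitting_time Z K w <= t%:E] `<=` hitting_event t.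
Proof.
move=> w /= h k _.
have : hitting_time Z K w < (t + k.+1%:R^-1)%:E.
  by apply: (le_lt_trans h); rewrite lte_fin ltrDl.
move=> /ereal_inf_lt[_ [q [q0 Kq] <-]]; rewrite lte_fin => qt.
have /ltr_add_invr[i] := q0; rewrite add0r => iq.
exists i => // j _; exists q; split=> //; first exact: ltW.
by apply: image_subset Kq; exact: KU.
Qed.

(** For given k the event supplies an i such that all entrance times from 1/(i+1) on are at most t +
    1/(k+1), and so is their limit, at which the path is in K by quasi-left-continuity. The
    exceptional set is a union of countably many null sets, one for each i. *)
Lemma hitting_event_ae y t :
  (P y).-negligible (hitting_event t `\` [set w | hitting_time Z K w <= t%:E]).
Proof.
pose e_ (i : nat) : R := i.+1%:R^-1%R.
have i0 i : (0 <= e_ i)%R by rewrite /e_.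
have qlc i := @hunt_quasi_left_continuous _ _ _ _ Z y
  (entrance_time (e_ i)) (entrance_limit (e_ i))
  (fun n => entrance_time_stopping n (i0 i))
  (fun w n => entrance_time_nd (e_ i) w (leqnSn n))
  (@entrance_time_cvg (e_ i)).
have := ae_foralln qlc; apply: negligibleS => w /= [hw nw] H; apply: nw.
apply/lee_addgt0Pr => e e0.
have /ltr_add_invr[k] := e0; rewrite add0r => ke.
have [i _ hi] := hw k I.
have lim_le : entrance_limit (e_ i) w <= (t + k.+1%:R^-1)%:E.
  apply: ge_ereal_sup => _ [j _ <-].
  by have /entrance_time_lt/ltW := hi j I.
have lim_fin : entrance_limit (e_ i) w < +oo by apply: (le_lt_trans lim_le); rewrite ltry.
have lim_ge : (e_ i)%:E <= entrance_limit (e_ i) w.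
  by apply: (le_trans (entrance_time_ge _ 0 w)); apply: ereal_sup_ubound; exists 0%N.
have fin : entrance_limit (e_ i) w \is a fin_num.
  by rewrite fin_numElt lim_fin andbT; apply: lt_le_trans lim_ge; rewrite ltNyr.
have Kq := entrance_limit_hits (i0 i) lim_fin (H i lim_fin).
apply: (@le_trans _ _ (entrance_limit (e_ i) w)).
  apply: ereal_inf_lbound; exists (fine (entrance_limit (e_ i) w)); last by rewrite fineK.
  by split=> //; rewrite -lte_fin fineK//; apply: lt_le_trans lim_ge; rewrite lte_fin /e_.
by apply: (le_trans lim_le); rewrite -EFinD lee_fin lerD2l ltW.
Qed.

Lemma hitting_time_ge0 w : 0 <= hitting_time Z K w.
Proof. by apply: le_ereal_inf_tmp => _ [q [q0 _] <-]; rewrite lee_fin ltW. Qed.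

Local Notation Pc x := (completed_law Z x).

Lemma completed_lawE x (A : set Omega) : measurable A -> Pc x A = P (Some x) A.
Proof. by move=> mA; exact: measurable_mu_extE. Qed.

Lemma completed_law_measurable x (A : set Omega) : measurable A ->
  measurable (A : set (caratheodory_type (P (Some x))^*%mu)).
Proof. by move=> mA; exact: caratheodory_measurable_mu_ext. Qed.

(** {sigma_K <= t} is [hitting_event t] minus a negligible set, so it belongs to the completion with
    the same mass. *)
Lemma hitting_time_completed x t :
  measurable ([set w | hitting_time Z K w <= t%:E] :
    set (caratheodory_type (P (Some x))^*%mu)) /\
  Pc x [set w | hitting_time Z K w <= t%:E] = P (Some x) (hitting_event t).
Proof.
set S := [set w | _]; have SH := @hitting_time_le_event t.
have [mH _] := hitting_event_law t.
have [B [mB B0 NB]] := hitting_event_ae (Some x) t.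
have mN : measurable (hitting_event t `\` S : set (caratheodory_type (P (Some x))^*%mu)).
  apply: measure_is_complete_caratheodory; exists B; split=> //.
    exact: completed_law_measurable.
  by rewrite -B0; exact: completed_lawE.
have mS : measurable (S : set (caratheodory_type (P (Some x))^*%mu)).
  have -> : S = hitting_event t `\` (hitting_event t `\` S).
    by rewrite setDD; apply/esym/setIidPr.
  by apply: measurableD => //; exact: completed_law_measurable.
split=> //; apply/eqP; rewrite eq_le -completed_lawE//; apply/andP; split.
  by apply: le_mu_ext.
apply: (@le_trans _ _ (Pc x (S `|` B))).
  apply: le_mu_ext => w Hw; have [Sw|nSw] := pselect (S w); first by left.
  by right; apply: NB.
have /le_trans := measureU2 (Pc x) mS (completed_law_measurable x mB); apply.
rewrite [X in _ + X](_ : _ = 0) ?adde0//.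
by rewrite -B0; exact: completed_lawE.
Qed.

Lemma hitting_probabilityE x t :
  hitting_probability Z K t x = fine (P (Some x) (hitting_event t)).
Proof. by rewrite /hitting_probability (hitting_time_completed x t).2. Qed.

Lemma Some_measurable : measurable_fun [set: borel X] (Some : borel X -> borel (opc X)).
Proof.
apply: (@measurability _ _ (borel X) (borel (opc X)) setT Some (@open (opc X))) => //.
move=> _ [B oB <-]; rewrite setTI.
apply: sub_sigma_algebra.
have := @one_point_compactification_some_continuous X.
by move/continuousP; exact.
Qed.

Lemma law_measurable_Some (A : set Omega) : law_measurable A ->
  measurable_fun [set: borel X] (fun x => fine (P (Some x) A)).
Proof.
move=> [_ mA]; apply: measurableT_comp => //.
exact: (measurableT_comp mA Some_measurable).
Qed.

Lemma hitting_probability_measurable t :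
  measurable_fun [set: borel X] (hitting_probability Z K t).
Proof.
rewrite (_ : hitting_probability Z K t = fun x => fine (P (Some x) (hitting_event t))).
  exact: law_measurable_Some (hitting_event_law t).
by apply/funext => x; exact: hitting_probabilityE.
Qed.

Let completed_law1 x : Pc x [set: _] = 1.
Proof. by rewrite completed_lawE// probability_setT. Qed.

Let msigma x t : (0 <= t)%R -> measurable ([set w | hitting_time Z K w <= t%:E] :
    set (caratheodory_type (P (Some x))^*%mu)).
Proof. by move=> _; exact: (hitting_time_completed x t).1. Qed.

Lemma equilibrium_potential_measurable :
  measurable_fun [set: borel X] (equilibrium_potential Z K).
Proof.
apply: (@measurable_fun_cvg _ (borel X) R setT
  (fun n (x : borel X) => laplace_sum n (fun t => hitting_probability Z K t x))).
  move=> n; apply: measurable_sum => k; apply: measurable_funM => //.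
  exact: hitting_probability_measurable.
move=> x _; apply: squeeze_invS => n.
exact: (@laplace_sum_bounds _ (caratheodory_type (P (Some x))^*%mu) R
  (completed_law Z x) (hitting_time Z K) hitting_time_ge0 (@msigma x)
  (completed_law1 x) n).
Qed.

Lemma equilibrium_potential_le x t : (0 <= t)%R ->
  (0 <= equilibrium_potential Z K x <= hitting_probability Z K t x + expR (- t))%R.
Proof.
exact: (@laplace_le _ (caratheodory_type (P (Some x))^*%mu) R
  (completed_law Z x) (hitting_time Z K) hitting_time_ge0 (@msigma x)
  (completed_law1 x) t).
Qed.

Lemma equilibrium_potential_ge x t (A : set Omega) : measurable A ->
  (forall w, A w -> hitting_time Z K w <= t%:E) ->
  (expR (- t) * fine (P (Some x) A) <= equilibrium_potential Z K x)%R.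
Proof.
move=> mA At; rewrite -completed_lawE//.
apply: (@laplace_ge _ (caratheodory_type (P (Some x))^*%mu) R
  (completed_law Z x) (hitting_time Z K) hitting_time_ge0 (@msigma x)
  (completed_law1 x) t A) => //.
exact: completed_law_measurable.
Qed.

End HittingCompact.

End Markov.

(** * Domination by excessive functions *)

Section Association.
Context {R : realType} {X : pmetricType R}.
Variable m : {measure set (borel X) -> \bar R}.
Hypothesis m_gt0 : (0 < m [set: X])%E.
Variables (F : set (X -> R)) (E : (X -> R) -> (X -> R) -> R).
Variable T : R -> (X -> R) -> X -> R.
Hypothesis T_L2 : is_L2_semigroup m F E T.
Context {d : measure_display} {Omega : measurableType d}.
Variable Z : hunt_process R X Omega.
Hypothesis Z_associated : associated_process Z m T.
Local Notation P := (hunt_law Z).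
Local Notation pth := (hunt_path Z).

Lemma semigroup_transition t f : 0 < t -> f \in Lfun m 2%:E ->
  \forall x \ae m,
    (T t f x)%:E = transition Z t (fun y : opc X => (oapp f 0 y)%:E) (Some x).
Proof.
move=> t0 f2; have := Z_associated t0 f2; apply: aeS => x ->.
apply: eq_integral => w _; case: ifPn => //; rewrite -leNgt => le_t.
by rewrite (hunt_absorbing (ltW t0) le_t).
Qed.

Lemma semigroup_pos t f : 0 < t -> f \in Lfun m 2%:E ->
  (forall x, 0 <= f x) -> \forall x \ae m, 0 <= T t f x.
Proof.
move=> t0 f2 f0; have := semigroup_transition t0 f2; apply: aeS => x e.
rewrite -lee_fin e; apply: transition_ge0 => -[y|] /=; by rewrite lee_fin.
Qed.

Lemma semigroup_indic_compact t K : 0 < t -> compact K -> (m K < +oo)%E ->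
  \forall x \ae m, T t \1_K x = fine (P (Some x) (pth t @^-1` (Some @` K))) /\
                   measurable (pth t @^-1` (Some @` K)).
Proof.
move=> t0 cK Kfin; have mK : borel_set X K by exact: borel_compact.
have [K2 _] := Lfun_indic mK Kfin.
have mSK : borel_set (opc X) (Some @` K).
  have -> : Some @` K = ~` (Some @` (~` K) `|` [set None]).
    apply/seteqP; split=> [_ [x Kx <-] [[y nKy []] yx|//]|[x|] /= h].
      by apply: nKy; rewrite yx.
      exists x => //; apply: contrapT => nKx; apply: h; left; by exists x.
    by exfalso; apply: h; right.
  apply: measurableC; apply: measurableU.
    apply: borel_open; apply: one_point_compactification_open_some.
    by apply: closed_openC; apply: compact_closed => //; exact: metric_hausdorff.
  exact: borel_None.
have := semigroup_transition t0 K2; apply: aeS => x e.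
split; last by apply: path_measurable_preimage => //; exact: ltW.
rewrite -transition_indic ?ltW// -[LHS]/(fine (T t \1_K x)%:E) e; congr fine.
apply: eq_integral => w _; case: (pth t w) => [y|] /=.
  congr (_%:E); rewrite !indicE; congr (nat_of_bool _)%:R.
  apply/idP/idP; rewrite !inE; first by exists y.
  by move=> [z Kz [<-]].
by rewrite indicE memNset// => -[].
Qed.

Section Domination.
Variables (phi : X -> R) (U : set X).
Hypothesis phi2 : phi \in Lfun m 2%:E.
Hypothesis phi_excessive : one_excessive m T phi.
Hypothesis phi_ge : \forall x \ae m, \1_U x <= phi x.
Hypothesis oU : open U.
Let V : set (opc X) := Some @` U.

Let oV : @open (opc X) V.
Proof. exact: one_point_compactification_open_some. Qed.

Let mV : borel_set (opc X) V. Proof. exact: borel_open. Qed.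

Let phi0 : \forall x \ae m, 0 <= phi x.
Proof. by move: phi_ge; apply: aeS => x; apply: le_trans. Qed.

(** [grid_hit] as a real function on X, the form in which the operators [T t] can be applied to
    it. *)
Let g (dl : R) n (x : X) : R := fine (grid_hit Z V dl n (Some x)).

Let gE dl n x : 0 <= dl -> (g dl n x)%:E = grid_hit Z V dl n (Some x).
Proof.
move=> dl0; rewrite /g fineK// ge0_fin_numE ?grid_hit_ge0//.
by apply: le_lt_trans (grid_hit_le1 Z mV dl0 n (Some x)) _; rewrite ltry.
Qed.

Let g_oapp dl n y : 0 <= dl -> (oapp (g dl n) 0 y)%:E = grid_hit Z V dl n y.
Proof.
move=> dl0; case: y => [x|] /=; first exact: gE.
by rewrite grid_hit_None// => -[].
Qed.

Let g_measurable dl n : 0 <= dl -> measurable_fun [set: borel X] (g dl n).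
Proof.
move=> dl0; apply: measurableT_comp => //.
apply: (measurableT_comp (grid_hit_measurable Z mV dl0 n)).
exact: Some_measurable.
Qed.

Let g_L2 dl n c : 0 <= dl -> (\forall x \ae m, g dl n x <= c * phi x) ->
  g dl n \in Lfun m 2%:E.
Proof.
move=> dl0 gc; apply: (Lfun2_le (g_measurable n dl0) (Lfun2_scale c phi2)).
move: gc; apply: aeS => x h; rewrite ger0_norm ?fine_ge0 ?grid_hit_ge0//.
by apply: (le_trans h); exact: ler_norm.
Qed.

(** Domination by c phi puts [g dl n] in L^2, where T_s is monotone; excessivity then gives T_s (c
    phi) <= c exp(s) phi. *)
Let T_g dl n c s : 0 <= dl -> 0 <= c -> 0 < s ->
  (\forall x \ae m, g dl n x <= c * phi x) ->
  \forall x \ae m, (transition Z s (grid_hit Z V dl n) (Some x) <=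
    (c * expR s * phi x)%:E)%E.
Proof.
move=> dl0 c0 s0 gc; have g2 := g_L2 dl0 gc; have s0' := ltW s0.
have m1 := semigroup_mono T_L2 semigroup_pos s0 g2 (Lfun2_scale c phi2) gc.
have m2 := semigroup_scale T_L2 c s0' phi2.
have m3 : \forall x \ae m, T s (g dl n) x <= c * expR s * phi x.
  move: m1 m2 (phi_excessive s0); apply: aeS3 => x h1 /(_ I) h2 h3.
  apply: (le_trans h1); rewrite h2 -mulrA ler_wpM2l//.
  by rewrite -ler_pdivrMl ?expR_gt0// -expRN.
move: m3 (semigroup_transition s0 g2); apply: aeS2 => x h e.
rewrite -lee_fin e in h; apply: le_trans h.
by rewrite /transition; under eq_integral do rewrite -g_oapp//.
Qed.

(** On U one has 1 <= phi; off U one more step of length dl multiplies the constant by exp(dl). *)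
Let g_le dl n : 0 < dl -> \forall x \ae m, g dl n x <= expR (n%:R * dl) * phi x.
Proof.
move=> dl0; have dl0' := ltW dl0; elim: n => [|n ih].
  move: phi_ge; apply: aeS => x; rewrite mul0r expR0 mul1r; apply: le_trans.
  rewrite /g /= !indicE; case: (boolP (Some x \in V)) => [|_]; last by case: (_ \in _).
  by rewrite inE => -[y Uy [yx]]; rewrite mem_set//= -yx.
move: phi_ge phi0 (T_g dl0' (expR_ge0 _) dl0 ih); apply: aeS3 => x h1 h0 h2.
rewrite -lee_fin gE//= !indicE in_setC; case: (boolP (Some x \in V)) => [|_].
  rewrite inE => -[y Uy [yx]]; rewrite mul0e adde0 lee_fin.
  have {}h1 : 1 <= phi x by move: h1; rewrite indicE mem_set// -yx.
  by apply: (le_trans h1); rewrite ler_peMl// -expR0 ler_expR mulr_ge0.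
rewrite /= mul1e add0e; apply: (le_trans h2); rewrite lee_fin ler_wpM2r//.
by rewrite -expRD ler_expR -natr1 mulrDl mul1r.
Qed.

Lemma grid_event_domination dl n s : 0 < dl -> 0 < s ->
  \forall x \ae m, (P (Some x) (grid_event Z V dl s n) <=
     (expR (s + n%:R * dl) * phi x)%:E)%E.
Proof.
move=> dl0 s0.
move: (T_g (ltW dl0) (expR_ge0 _) s0 (g_le n dl0)); apply: aeS => x.
rewrite -expRD [_ + s]addrC; apply: le_trans.
by rewrite grid_event_transition// ltW.
Qed.

(** All grid times stay below t, so the bound exp(t) phi is the same for every mesh and survives the
    increasing limit; only countably many null sets are discarded. *)
Lemma visit_domination s t : 0 < s ->
  \forall x \ae m, (P (Some x) (visit Z V s t) <= (expR t * phi x)%:E)%E.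
Proof.
move=> s0; have [ts|st] := leP t s.
  rewrite visit_empty//; move: phi0; apply: aeS => x px.
  by rewrite measure0 lee_fin mulr_ge0// expR_ge0.
have [n_ [-> nmono nt]] := visit_gridE Z oV (ltW s0) st.
have h0 l : 0 < (2^-1 : R) ^+ l by rewrite exprn_gt0.
have /ae_foralln H : forall l, \forall x \ae m,
    (P (Some x) (grid_event Z V (2^-1 ^+ l) s (n_ l)) <= (expR t * phi x)%:E)%E.
  move=> l; move: phi0 (grid_event_domination (n_ l) (h0 l) s0); apply: aeS2 => x px.
  move=> /le_trans; apply; rewrite lee_fin ler_wpM2r// ler_expR; exact: ltW.
move: H; apply: aeS => x H.
have mG l : measurable (grid_event Z V (2^-1 ^+ l) s (n_ l)).
  by apply: grid_event_measurable => //; exact: ltW.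
have Gmono : nondecreasing_seq (fun l => grid_event Z V (2^-1 ^+ l) s (n_ l)).
  by apply/nondecreasing_seqP => l; rewrite subsetEset.
have mU := bigcup_measurable (fun l (_ : [set: nat] l) => mG l).
have cv := @nondecreasing_cvg_mu _ _ _ (P (Some x)) _ mG mU Gmono.
rewrite -(cvg_lim _ cv)//; apply: lime_le; first exact: cvgP cv.
by apply: nearW => l; exact: H.
Qed.

(** The indices k = 0 and j = 0 in [hitting_event t] already give a visit to U before t + 1 at a
    time bounded away from 0; this is the origin of the constant exp(t + 1). *)
Lemma hitting_domination (K : set X) (U_ : nat -> set X) t :
  (forall n, open (U_ n)) -> (forall n, K `<=` U_ n) ->
  (forall n, U_ n.+1 `<=` U_ n) ->
  (forall y : opc X, ~ (Some @` K) y ->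
     exists2 W, nbhs y W & exists n, W `&` Some @` U_ n = set0) ->
  U_ 0%N = U ->
  \forall x \ae m, hitting_probability Z K t x <= expR (t + 1) * phi x.
Proof.
move=> oU_ KU_ Umono Usep U0.
pose A i := visit Z V i.+1%:R^-1 (t + 1).
have A_law i : law_measurable Z (A i) by exact: law_measurable_visit.
have Amono i : A i `<=` A i.+1.
  move=> w [q [iq qt Vq]]; exists q; split=> //.
  by apply: le_trans iq; rewrite lef_pV2 ?posrE// ler_nat.
have /ae_foralln H : forall i, \forall x \ae m,
    (P (Some x) (A i) <= (expR (t + 1) * phi x)%:E)%E.
  by move=> i; exact: visit_domination.
move: H; apply: aeS => x H.
have mA i : measurable (A i) by exact: (A_law i).1.
have mUA := bigcup_measurable (fun i (_ : [set: nat] i) => mA i).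
have ndA : nondecreasing_seq A.
  by apply/nondecreasing_seqP => i; rewrite subsetEset; exact: Amono.
have cv := @nondecreasing_cvg_mu _ _ _ (P (Some x)) _ mA mUA ndA.
have UA : (P (Some x) (\bigcup_i A i) <= (expR (t + 1) * phi x)%:E)%E.
  rewrite -(cvg_lim _ cv)//; apply: lime_le; first exact: cvgP cv.
  by apply: nearW => i; exact: H.
have [mH _] := hitting_event_law Z oU_ Umono t.
rewrite (hitting_probabilityE Z oU_ KU_ Umono Usep) -lee_fin fineK; last first.
  by rewrite ge0_fin_numE// (le_lt_trans (probability_le1 _ mH))// ltry.
apply: le_trans UA; apply: le_measure; rewrite ?inE// => w Hw.
have [i _ hi] := Hw 0%N I; exists i => //.
by have := hi 0%N I; rewrite U0 invr1.
Qed.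

End Domination.
End Association.

(** * The implications between the four assertions *)

Section Equivalence.
Context {R : realType} {X : pmetricType R}.
Hypothesis X_locally_compact : locally_compact [set: X].
Hypothesis X_separable : separable_space X.

(** The separation clause must also cover the point at infinity, since a limit of entrance points is
    a priori a point of the compactification. There the complement of L serves, all [U n] being
    contained in the compact L. *)
Lemma compact_shrinking_opc (K : set X) : compact K ->
  exists (L : set X) (U : nat -> set X), [/\ compact L,
    forall n, open (U n), forall n, K `<=` U n, forall n, U n.+1 `<=` U n &
    (forall n, U n `<=` L) /\
    forall y : opc X, ~ (Some @` K) y ->
      exists2 W, nbhs y W & exists n, W `&` Some @` U n = set0].
Proof.
move=> cK.
have [L [U [cL oU KU Umono [UL Usep]]]] :=
  compact_shrinking_nbhs X_locally_compact X_separable cK.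
exists L, U; split=> //; split=> // -[x|] nK.
  have [|W [oW Wx] [n Wn]] := Usep x; first by move=> Kx; apply: nK; exists x.
  exists (Some @` W).
    by apply: one_point_compactification_some_nbhs; exact: open_nbhs_nbhs.
  exists n; rewrite -subset0 => _ [[y Wy <-] [z Uz [zy]]].
  have : (W `&` U n) y by split=> //; rewrite -zy.
  by rewrite Wn.
exists (Some @` (~` L) `|` [set None]).
  exists L => //; split=> //; apply: compact_closed => //; exact: metric_hausdorff.
exists 0%N; rewrite -subset0 => y [[[x nLx <-]|->] [z Uz]] //.
by move=> [zx]; apply: nLx; rewrite -zx; exact: (UL 0%N).
Qed.

Variable m : {measure set (borel X) -> \bar R}.
Hypothesis m_radon : radon_measure m.
Hypothesis m_gt0 : (0 < m [set: X])%E.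
Variables (F : set (X -> R)) (E : (X -> R) -> (X -> R) -> R).
Hypothesis F_L2 : forall u, F u -> u \in Lfun m 2%:E.
Variable T : R -> (X -> R) -> X -> R.
Hypothesis T_L2 : is_L2_semigroup m F E T.
Hypothesis T_Linfty : is_Linfty_semigroup m T.
Variable G : R -> (X -> R) -> X -> R.
Hypothesis G_resolvent : is_resolvent m F E G.
Hypothesis G_P : property_P m G.
Context {d : measure_display} {Omega : measurableType d}.
Variable Z : hunt_process R X Omega.
Hypothesis Z_associated : associated_process Z m T.

Definition excessive_majorants := forall K : set X, compact K ->
  exists phi : X -> R, [/\ F phi, one_excessive m T phi,
    \forall x \ae m, \1_K x <= phi x & Linfty0 m phi].

Let T_pos := semigroup_pos Z_associated.

Lemma diffusion_excessive_majorants :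
  Linfty0_diffusion m T -> excessive_majorants.
Proof.
move=> Tdiff K cK; have [w [w2 w0 wpos wK]] := G_P cK.
have [FG f2 GE] := G_resolvent ltr01 w2.
have GwE : (fun x => w x - 1 * G 1 w x) = (fun x => w x - G 1 w x).
  by apply/funext => x; rewrite mul1r.
have uw : form_operator m F E (G 1 w) (fun x => w x - G 1 w x).
  by rewrite -GwE; split.
have u2 := F_L2 FG.
have woo := w0.1.
exists (G 1 w); split=> //.
- exact: (resolvent_excessive T_L2 T_Linfty T_pos uw u2 w2 woo wpos).
- exact: (resolvent_Linfty0 m_gt0 T_L2 T_Linfty uw u2 w2 woo
    X_locally_compact X_separable Tdiff w0).
Qed.

(** The majorant is taken for the compact L instead of K: it then dominates the indicator of the
    open set [U 0], as the grid argument requires. *)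
Lemma excessive_majorants_hitting (K : set X) t : compact K -> 0 <= t ->
  excessive_majorants -> in_Linfty0 m (hitting_probability Z K t).
Proof.
move=> cK t0 majorants.
have [L [U [cL oU KU Umono [UL Usep]]]] := compact_shrinking_opc cK.
have [phi [Fphi phi_exc phi_ge phi0]] := majorants L cL.
exists (hitting_probability Z K t); last exact: ae_eq_refl.
apply: (Linfty0_le (c := expR (t + 1)) m_gt0 _ phi0).
  exact: (hitting_probability_measurable Z oU KU Umono Usep).
have phiU : \forall x \ae m, \1_(U 0%N) x <= phi x.
  move: phi_ge; apply: aeS => x; apply: le_trans; rewrite !indicE ler_nat.
  case: (boolP (x \in U 0%N)) => //; rewrite inE => /UL Lx.
  by rewrite mem_set.
have := hitting_domination T_L2 Z_associated (F_L2 Fphi) phi_exc phiU (oU 0%N) t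
  oU KU Umono Usep erefl.
apply: aeS => x h; rewrite ger0_norm; last by rewrite /hitting_probability fine_ge0.
by apply: (le_trans h); rewrite ler_wpM2l ?expR_ge0// ler_norm.
Qed.

Lemma hitting_equilibrium (K : set X) : compact K ->
  (forall t, 0 <= t -> in_Linfty0 m (hitting_probability Z K t)) ->
  in_Linfty0 m (equilibrium_potential Z K).
Proof.
move=> cK hit0.
have [L [U [cL oU KU Umono [UL Usep]]]] := compact_shrinking_opc cK.
have eK_le := equilibrium_potential_le Z oU KU Umono Usep.
exists (equilibrium_potential Z K); last exact: ae_eq_refl.
apply/Linfty0P => //; split.
- exact: (equilibrium_potential_measurable Z oU KU Umono Usep).
(* At t = 0 the estimate reads e_K <= P(sigma_K <= 0) + 1, which is bounded. *)
- have [v v0 e] := hit0 0 (lexx 0).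
  have /Linfty0P-/(_ m_gt0)[_ [c vc] _] := v0.
  exists (c + 1); move: e vc; apply: aeS2 => x /(_ I) e vc.
  have /andP[h0 h1] := eK_le x 0 (lexx 0).
  rewrite ger0_norm//; apply: (le_trans h1); rewrite oppr0 expR0 lerD2r e.
  by apply: le_trans vc; exact: ler_norm.
- move=> e e0; have e20 : 0 < e / 2 by rewrite divr_gt0.
  have [t t0 te] : exists2 t : R, 0 <= t & expR (- t) <= e / 2.
    exists (e / 2)^-1; first by rewrite invr_ge0 ltW.
    rewrite expRN invf_ple ?posrE ?expR_gt0//.
    by apply: le_trans (expR_ge1Dx _); rewrite lerDr.
  have [v v0 ve] := hit0 t t0.
  have /Linfty0P-/(_ m_gt0)[_ _ /(_ _ e20)[C cC vC]] := v0.
  exists C => //; move: ve vC; apply: aeS2 => x /(_ I) ve vC nCx.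
  have /andP[h0 h1] := eK_le x t t0.
  rewrite ger0_norm//; apply: (le_trans h1); rewrite [leRHS]splitr lerD// ve.
  by apply: le_trans (vC nCx); exact: ler_norm.
Qed.

Let m_compact (K : set X) : compact K -> (m K < +oo)%E.
Proof. exact: radon_finite m_radon K. Qed.

Lemma equilibrium_diffusion :
  (forall K : set X, compact K -> in_Linfty0 m (equilibrium_potential Z K)) ->
  Linfty0_diffusion m T.
Proof.
move=> eK0; apply: (diffusion_of_compact_bound m_gt0 T_L2 T_Linfty T_pos m_compact).
move=> t K t0 cK; have [v v0 e] := eK0 K cK.
have [L [U [cL oU KU Umono [UL Usep]]]] := compact_shrinking_opc cK.
exists v, (expR t); split=> //.
move: (semigroup_indic_compact Z_associated t0 cK (m_compact cK)) e.
apply: aeS2 => x [-> mA] /(_ I) e.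
rewrite ger0_norm ?fine_ge0// -ler_pdivrMl ?expR_gt0// -expRN.
apply: le_trans (ler_norm _); rewrite -e.
have At w : (hunt_path Z t @^-1` (Some @` K)) w -> (hitting_time Z K w <= t%:E)%E.
  by move=> Kw; apply: ereal_inf_lbound; exists t.
exact: (@equilibrium_potential_ge _ _ _ _ Z K U oU KU Umono Usep x t _ mA At).
Qed.

End Equivalence.

Theorem theorem3p3 (R : realType) (X : pmetricType R)
  (X_locally_compact : locally_compact [set: X])
  (X_separable : separable_space X)
  (m : {measure set (borel X) -> \bar R})
  (m_radon : radon_measure m)
  (m_full_support : full_support m)
  (F : set (X -> R)) (E : (X -> R) -> (X -> R) -> R)
  (E_form : semi_dirichlet_form m F E)
  (E_regular : regular_form m F E)
  (T : R -> (X -> R) -> X -> R)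
  (T_L2 : is_L2_semigroup m F E T)
  (T_Linfty : is_Linfty_semigroup m T)
  (G : R -> (X -> R) -> X -> R)
  (G_resolvent : is_resolvent m F E G)
  (d : measure_display) (Omega : measurableType d)
  (Z : hunt_process R X Omega)
  (Z_associated : associated_process Z m T)
  (P : property_P m G) :
  [<-> Linfty0_diffusion m T;
       forall (K : set X) (t : R), compact K -> 0 <= t ->
         in_Linfty0 m (hitting_probability Z K t);
       forall K : set X, compact K ->
         in_Linfty0 m (equilibrium_potential Z K);
       forall K : set X, compact K -> exists phi : X -> R,
         [/\ F phi, one_excessive m T phi,
             \forall x \ae m, \1_K x <= phi x & Linfty0 m phi]].
Proof.
have m_gt0 : (0 < m [set: X])%E.
  (* The state space is pointed, hence nonempty. *)
  by apply: m_full_support openT _; exists point.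
have F_L2 u : F u -> u \in Lfun m 2%:E by exact: form_dom_L2 E_form u.
have majorants := diffusion_excessive_majorants X_locally_compact X_separable
  m_gt0 F_L2 T_L2 T_Linfty G_resolvent P Z_associated.
have diffusion := equilibrium_diffusion X_locally_compact X_separable m_radon
  m_gt0 T_L2 T_Linfty Z_associated.
have hitting K t cK t0 := @excessive_majorants_hitting _ _ X_locally_compact
  X_separable _ m_gt0 _ _ F_L2 _ T_L2 _ _ Z Z_associated K t cK t0.
have equilibrium := hitting_equilibrium X_locally_compact X_separable m_gt0 (Z := Z).
(* The lemmas form the cycle (1) => (4) => (2) => (3) => (1); the consecutive implications asked for
   here are obtained by composing them. *)
tfae.
- by move=> /majorants maj K t cK t0; exact: hitting.
- by move=> hit K cK; apply: equilibrium => // t t0; exact: hit.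
- by move=> /diffusion/majorants.
- move=> maj; apply: diffusion => K cK; apply: equilibrium => // t t0.
  exact: hitting.
Qed.
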